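(* Let $(X,\mathrm{d}\mu)$ be a $\sigma$-finite measure space and, for $1\le j\le d$, let $\mathcal{Y}_j$ be a $p_j$-convex normed lattice for some $1\le p_j<\infty$. Let $T_j:\mathcal{Y}_j\to\mathcal{M}(X)$ be positive linear operators, each of which saturates $X$. Let $\theta_j>0$ with $\sum_{j=1}^d\theta_j=1$. Suppose that for some $0<q\le\infty$ we have $$\Big\|\prod_{j=1}^d(T_jf_j)^{p_j\theta_j}\Big\|_{L^q(\mathrm{d}\mu)}\le B\prod_{j=1}^d\|f_j\|_{\mathcal{Y}_j}^{p_j\theta_j}$$ for all nonnegative $f_j\in\mathcal{Y}_j$, $1\le j\le d$. Case I (Disentanglement). If $q=1$, then there exist nonnegative measurable functions $\phi_j$ on $X$ such that $\prod_{j=1}^d\phi_j(x)^{\theta_j}\ge 1$ a.e. on $X$ and such that for each $j$, $\left(\int_X|T_jf_j|^{p_j}\phi_j\,\mathrm{d}\mu\right)^{1/p_j}\le B^{1/p_j}C_{p_j}(\mathcal{Y}_j)\|f_j\|_{\mathcal{Y}_j}$ for all $f_j\in\mathcal{Y}_j$. Case II (Multilinear duality). If $q>1$, then for every nonnegative $G\in L^{q'}(X)$ there exist nonnegative measurable functions $g_j$ on $X$ such that $$G(x)\le\prod_{j=1}^dg_j(x)^{\theta_j}\quad\text{a.e. on }X,$$ and such that for each $j$, $$\left(\int_X|T_jf_j(x)|^{p_j}g_j(x)\,\mathrm{d}\mu(x)\right)^{1/p_j}\le B^{1/p_j}C_{p_j}(\mathcal{Y}_j)\|G\|_{q'}^{1/p_j}\|f_j\|_{\mathcal{Y}_j}\quad\text{for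 all } f_j\in\mathcal{Y}_j.$$ Case III (Multilinear Maurey factorisation). If $0<q<1$, then there exist nonnegative measurable functions $g_j$ on $X$ such that $$\Big\|\prod_{j=1}^dg_j^{\theta_j}\Big\|_{q'}=1$$ and such that for each $j$, $$\left(\int_X|T_jf_j(x)|^{p_j}g_j(x)\,\mathrm{d}\mu(x)\right)^{1/p_j}\le B^{1/p_j}C_{p_j}(\mathcal{Y}_j)\|f_j\|_{\mathcal{Y}_j}\quad\text{for all } f_j\in\mathcal{Y}_j.$$
   Context: $\mathcal{M}(X)$ is the class of measurable functions on $X$. A linear operator is positive if it maps nonnegative elements to (a.e.) nonnegative functions. A linear map $T:\mathcal{Y}\to\mathcal{M}(X)$ saturates $X$ if for each measurable $E\subseteq X$ of positive measure there exist a measurable $E'\subseteq E$ with $\mu(E')>0$ and an $h\in\mathcal{Y}$ such that $|Th|>0$ a.e. on $E'$. For $1\le p<\infty$, a normed lattice $\mathcal{Y}$ is $p$-convex if there is a finite constant $C$ such that for all finite sequences $(f_k)$ in $\mathcal{Y}$, $\big\|(\sum_k|f_k|^p)^{1/p}\big\|_{\mathcal{Y}}\le C(\sum_k\|f_k\|_{\mathcal{Y}}^p)^{1/p}$; the least such constant is denoted $C_p(\mathcal{Y})$. Here $(\sum_k|f_k|^p)^{1/p}\in\mathcal{Y}$ is understood in the usual sense of lattice functional calculus (pointwise in a lattice of functions). For $q\in(0,\infty)\setminus\{1\}$, $q':=q/(q-1)$ (and $q'=1$ if $q=\infty$), so $q'<0$ when $0<q<1$; the notation $\|g\|_s:=(\int_X|g|^s\,\mathrm{d}\mu)^{1/s}$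 is used also for $s<0$ and $0<s<1$.
   Formalization: In Case III the measure space is additionally assumed to have positive measure, μ(X) > 0; for the null measure all hypotheses hold but the normalisation ‖∏ g_j^{θ_j}‖_{q'} = 1 is impossible. *)

(* Defs.v *)
From HB Require Import structures.
From mathcomp Require Import all_boot all_order all_algebra.
From mathcomp Require Import all_classical all_reals all_analysis.

Set Implicit Arguments.
Unset Strict Implicit.
Unset Printing Implicit Defensive.

Import Order.TTheory GRing.Theory Num.Theory.
Import numFieldNormedType.Exports.

Local Open Scope classical_set_scope.
Local Open Scope ring_scope.

(* The order is not taken from Order.Lattice because mathcomp has no join of
   that structure with the additive ones.  Meets exist as
   x /\ y = - ((- x) \/ (- y)); completeness of the norm is not assumed.
   The lattice modulus |x| is x \/ (- x), whereas `|x| is the norm of x. *)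
HB.mixin Record NormedModule_isNormedLattice (R : realType) Y
    & NormedModule R Y := {
  lle : Y -> Y -> Prop ;
  ljoin : Y -> Y -> Y ;
  lle_refl : forall x, lle x x ;
  lle_anti : forall x y, lle x y -> lle y x -> x = y ;
  lle_trans : forall y x z, lle x y -> lle y z -> lle x z ;
  ljoin_lub : forall x y z, lle (ljoin x y) z <-> lle x z /\ lle y z ;
  lleD2r : forall z x y, lle x y -> lle (x + z) (y + z) ;
  lle_scale : forall (a : R) x, 0 <= a -> lle 0 x -> lle 0 (a *: x) ;
  ler_lnorm : forall x y,
    lle (ljoin x (- x)) (ljoin y (- y)) -> `|x| <= `|y|
}.

#[short(type=normedLatticeType)]
HB.structure Definition NormedLattice (R : realType) :=
  {Y of NormedModule R Y & NormedModule_isNormedLattice R Y}.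

Section functional_calculus.
Context (R : realType) (Y : normedLatticeType R).

Definition vector_sublattice n (D : set (('I_n -> R) -> R)) : Prop :=
  (forall a g h, D g -> D h -> D (fun x => a * g x + h x)) /\
  (forall g h, D g -> D h -> D (fun x => Num.max (g x) (h x))).

Definition lattice_morphism_on n (D : set (('I_n -> R) -> R))
    (tau : (('I_n -> R) -> R) -> Y) : Prop :=
  (forall a g h, D g -> D h ->
     tau (fun x => a * g x + h x) = a *: tau g + tau h) /\
  (forall g h, D g -> D h ->
     tau (fun x => Num.max (g x) (h x)) = ljoin (tau g) (tau h)).

(* [lattice_fcalc h f z] says that h(f_0, ..., f_(n-1)) exists in Y and is z,
   in the sense of Krivine's calculus: z is the image of h under a lattice
   homomorphism that maps the k-th coordinate function to f_k.  As Y need not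
   be complete, the homomorphism is only required on some vector lattice of
   functions that contains h and the coordinates.  For h continuous and
   positively homogeneous, z is unique. *)
Definition lattice_fcalc n (h : ('I_n -> R) -> R) (f : 'I_n -> Y) (z : Y) :
    Prop :=
  exists D tau, [/\ vector_sublattice D, lattice_morphism_on D tau,
    forall k, D (fun x => x k) /\ tau (fun x => x k) = f k,
    D h & tau h = z].

(* z = (\sum_k |f_k|^p)^(1/p) *)
Definition lattice_psum (p : R) n (f : 'I_n -> Y) (z : Y) : Prop :=
  lattice_fcalc (fun x => (\sum_k `|x k| `^ p) `^ p^-1) f z.

Definition pconvex_with (p C : R) : Prop :=
  forall n (f : 'I_n -> Y), exists2 z : Y,
    lattice_psum p f z & `|z| <= C * (\sum_k `|f k| `^ p) `^ p^-1.

End functional_calculus.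

Definition pconvex (R : realType) (Y : normedLatticeType R) (p : R) : Prop :=
  exists C : R, pconvex_with Y p C.

(* C_p(Y); the constraint 0 <= C only matters for Y = {0}. *)
Definition pconvexity_constant (R : realType) (Y : normedLatticeType R)
    (p : R) : R :=
  inf [set C : R | 0 <= C /\ pconvex_with Y p C].

(* Elements of M(X) are given by representatives, hence the a.e. equality. *)
Section operators.
Context (R : realType) (d : measure_display) (X : measurableType d).
Variables (mu : {measure set X -> \bar R}) (Y : normedLatticeType R).
Variable T : Y -> {mfun X >-> R}.

Definition ae_linear : Prop := forall (a : R) (f g : Y),
  {ae mu, forall x, T (a *: f + g) x = a * T f x + T g x}.

Definition positive_operator : Prop := forall f : Y, lle 0 f ->
  {ae mu, forall x, 0 <= T f x}.

Definition saturates : Prop := forall E : set X,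
  measurable E -> (0 < mu E)%E ->
  exists E' : set X, [/\ measurable E', E' `<=` E, (0 < mu E')%E &
    exists h : Y, {ae mu, forall x, E' x -> 0 < `|T h x|}].

End operators.

(* The library powers satisfy 0 `^ s = 0 and +oo `^ s = +oo when s < 0; here
   0 ^ s = +oo and +oo ^ s = 0. *)
Definition epow (R : realType) (x : \bar R) (s : R) : \bar R :=
  if s < 0 then ((x `^ (- s))^-1)%E else (x `^ s)%E.

(* (\int |g|^s)^(1/s) for s <> 0 of either sign. *)
Definition pow_norm (R : realType) (d : measure_display) (X : measurableType d)
    (mu : {measure set X -> \bar R}) (s : R) (g : X -> R) : \bar R :=
  epow (\int[mu]_x epow `|g x|%:E s)%E s^-1.

Lemma pow_norm_Lnorm (R : realType) (d : measure_display)
    (X : measurableType d) (mu : {measure set X -> \bar R}) (s : R)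
    (g : X -> R) :
  0 < s -> pow_norm mu s g = ('N[mu]_(s%:E) [EFin \o g])%E.
Proof.
move=> s0; rewrite unlock /pow_norm /epow invr_lt0 ltNge (ltW s0) /=.
by [].
Qed.

(* Main.v *)
Require Import Defs.
From HB Require Import structures.
From mathcomp Require Import all_boot all_order all_algebra.
From mathcomp Require Import all_classical all_reals all_analysis.
From mathcomp Require Import measurable_realfun ess_sup_inf.
From mathcomp Require Import ring lra.

Set Implicit Arguments.
Unset Strict Implicit.
Unset Printing Implicit Defensive.

Import Order.TTheory GRing.Theory Num.Theory.
Import numFieldNormedType.Exports.

Local Open Scope classical_set_scope.
Local Open Scope ring_scope.

(** The proof is a duality argument in which the dual object is read off from a
maximiser.  For each j let K_j be the set of all functions
C_j^(-p_j) \sum_k a_k |T_j f_k|^(p_j) with f_k >= 0, a_k >= 0 and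
\sum_k a_k |f_k|^(p_j) <= 1, where C_j is the p_j-convexity constant.  This set
is convex.  By p_j-convexity and positivity, each of its elements is at most
(T_j F)^(p_j) for some F >= 0 of norm arbitrarily close to 1
([power_sums_dominated]).  So the hypothesis bounds the L^q norm of the
geometric mean \prod_j u_j^theta_j by B for all u_j in K_j.

Let q = 1, and suppose that u maximises \int \prod_j u_j^theta_j over the product
of the K_j.  Moving u_j towards v in K_j does not increase the integral, and the
first variation reads \int v phi_j <= B with
phi_j = \prod_i u_i^theta_i / u_j; moreover \prod_j phi_j^theta_j = 1 wherever
all u_j are positive.  These are the required weights.  A maximiser need not
exist, and it may vanish on large sets.  Therefore [perturbed_maximiser] treats
u + eps w for a fixed w in the product of the K_j, and near-maximisers instead
of maximisers.  Near-maximisers form a decreasing sequence of convex families,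
because the geometric mean is concave; and from every such sequence of families
of nonnegative functions one can select an almost everywhere convergent sequence
([forward_convex_compactness]).  Fatou's lemma then carries the variational
inequality to the limit.  The weights found for a given eps and w again form
convex families, so the same principle lets eps tend to 0 while w exhausts X,
which is possible because the T_j saturate X; this is [disentanglement].

The other exponents reduce to [disentanglement].  If q > 1, Hoelder's inequality
allows K_j to be replaced by the set of all G u with u in K_j, and
g_j = G phi_j.  If q < 1, one adds to the d sets the set of measurable functions
with values in [0, 1], and uses the exponents q theta_1, ..., q theta_d, 1 - q.
The weight psi that belongs to the added set satisfies \int psi <= B^q, and
(\prod_j phi_j^theta_j)^q psi^(1-q) >= 1 means (\prod_j phi_j^theta_j)^q' <= psi;
a rescaling of the phi_j gives the normalisation. *)

(** * The weighted geometric mean *)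

Section geometric_mean.
Context {R : realType} {I : finType}.
Implicit Types (theta z a b : I -> R).

Definition gmean theta z : R := \prod_j z j `^ theta j.

Lemma gmean_ge0 theta z : 0 <= gmean theta z.
Proof. by apply: prodr_ge0 => j _; exact: powR_ge0. Qed.

Lemma gmean_gt0 theta z : (forall j, 0 < z j) -> 0 < gmean theta z.
Proof. by move=> z0; apply: prodr_gt0 => j _; exact: powR_gt0. Qed.

Lemma gmeanM theta a b : (forall j, 0 <= a j) -> (forall j, 0 <= b j) ->
  gmean theta (fun j => a j * b j) = gmean theta a * gmean theta b.
Proof.
by move=> a0 b0; rewrite /gmean -big_split/=; apply: eq_bigr => j _;
  rewrite powRM.
Qed.

Lemma gmean_eq0 theta z j : theta j != 0 -> z j = 0 -> gmean theta z = 0.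
Proof. by move=> tj zj; rewrite /gmean (bigD1 j)//= zj powR0// mul0r. Qed.

Lemma gmean_cst theta (s : R) : \sum_j theta j = 1 -> 0 < s ->
  gmean theta (fun=> s) = s.
Proof.
move=> t1 s0; rewrite /gmean.
under eq_bigr do rewrite /powR gt_eqF//.
by rewrite -expR_sum -mulr_suml t1 mul1r lnK.
Qed.

Lemma gmeanZ theta (s : R) z : \sum_j theta j = 1 ->
  (forall j, 0 < theta j) -> 0 <= s -> (forall j, 0 <= z j) ->
  gmean theta (fun j => s * z j) = s * gmean theta z.
Proof.
move=> t1 t0; rewrite le_eqVlt => /predU1P[<- z0|s0 z0]; last first.
  by rewrite gmeanM ?gmean_cst// => j; exact: ltW.
have [j _|I0] := pickP (fun _ : I => true).
  by rewrite mul0r (@gmean_eq0 _ _ j) ?mul0r// gt_eqF.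
by move: t1; rewrite big_pred0// => /eqP; rewrite eq_sym oner_eq0.
Qed.

(** The tangent inequality ln y <= y - 1 at y = z_j / m, where m is the
geometric mean, summed with the weights theta_j. *)
Lemma gmean_le_sum theta z : \sum_j theta j = 1 ->
  (forall j, 0 < theta j) -> (forall j, 0 <= z j) ->
  gmean theta z <= \sum_j theta j * z j.
Proof.
move=> t1 t0 z0.
have [j /eqP zj|zneq0] := pickP (fun j => z j == 0).
  rewrite (@gmean_eq0 _ _ j) ?gt_eqF//.
  by apply: sumr_ge0 => i _; rewrite mulr_ge0// ltW.
have {zneq0}z_gt0 j : 0 < z j by rewrite lt0r zneq0 z0.
have m0 := gmean_gt0 theta z_gt0.
set m := gmean theta z in m0 *.
have lnm : ln m = \sum_j theta j * ln (z j).
  rewrite -[RHS]expRK expR_sum; congr ln; apply: eq_bigr => j _.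
  by rewrite /powR gt_eqF.
have E : \sum_j theta j * (1 + ln (z j) - ln m) = 1.
  under eq_bigr do rewrite -addrA mulrDr mulr1 mulrBr.
  by rewrite big_split/= sumrB -lnm -mulr_suml t1 mul1r subrr addr0.
rewrite -[leLHS]mul1r -ler_pdivlMr// mulr_suml -E.
apply: ler_sum => j _; rewrite -mulrA ler_pM2l//.
have zm : 0 < z j / m by rewrite divr_gt0.
have := @le_ln1Dx R (z j / m - 1); rewrite ltrBrDl subrr => /(_ zm).
by rewrite addrC subrK ln_div ?posrE//; lra.
Qed.

(** The arithmetic-geometric mean inequality for the ratios a_j / (a_j + b_j)
and b_j / (a_j + b_j), whose weighted means add up to 1. *)
Lemma gmean_superadditive theta a b : \sum_j theta j = 1 ->
  (forall j, 0 < theta j) -> (forall j, 0 <= a j) -> (forall j, 0 <= b j) ->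
  gmean theta a + gmean theta b <= gmean theta (fun j => a j + b j).
Proof.
move=> t1 t0 a0 b0.
have ab0 j : 0 <= a j + b j by rewrite addr_ge0.
have [j /eqP|neq0] := pickP (fun j => a j + b j == 0).
  move=> abj; have aj : a j = 0 by have := a0 j; have := b0 j; lra.
  have bj : b j = 0 by have := a0 j; have := b0 j; lra.
  by rewrite !(@gmean_eq0 _ _ j) ?gt_eqF// addr0.
pose c j := a j + b j.
have c0 j : 0 < c j by rewrite lt0r neq0 ab0.
have E z : (forall j, 0 <= z j) ->
    gmean theta z <= (\sum_j theta j * (z j / c j)) * gmean theta c.
  move=> z0; have zc0 j : 0 <= z j / c j := divr_ge0 (z0 j) (ab0 j).
  have {1}-> : z = fun j => z j / c j * c j.
    by apply/funext => j; rewrite divfK ?gt_eqF.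
  rewrite (gmeanM theta zc0 ab0) ler_wpM2r ?gmean_ge0//.
  exact: gmean_le_sum.
apply: le_trans (lerD (E _ a0) (E _ b0)) _.
rewrite -mulrDl -big_split/= ler_piMl ?gmean_ge0//.
rewrite -[leRHS]t1 ler_sum// => j _.
by rewrite -mulrDr -mulrDl -[a j + b j]/(c j) divff ?mulr1// gt_eqF.
Qed.

Lemma gmean_concave theta (t : R) a b : \sum_j theta j = 1 ->
  (forall j, 0 < theta j) -> (forall j, 0 <= a j) -> (forall j, 0 <= b j) ->
  0 <= t <= 1 ->
  (1 - t) * gmean theta a + t * gmean theta b <=
  gmean theta (fun j => (1 - t) * a j + t * b j).
Proof.
move=> t1 t0 a0 b0 /andP[tge0 tle1]; have t'0 : 0 <= 1 - t by lra.
rewrite -!gmeanZ//; apply: gmean_superadditive => // j; exact: mulr_ge0.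
Qed.

End geometric_mean.

Section power_limits.
Context {R : realType}.

Lemma powR_le_affine (x th : R) : 0 <= x -> 0 < th < 1 ->
  x `^ th <= 1 + th * (x - 1).
Proof.
move=> x0 /andP[th0 th1].
have := @gmean_le_sum R bool (fun b => if b then th else 1 - th)
  (fun b => if b then x else 1).
rewrite /gmean !big_bool/= powR1 !mulr1 => H.
have -> : 1 + th * (x - 1) = th * x + (1 - th) by ring.
by apply: H => [|[]|[]]//; lra.
Qed.

Lemma cvg_powR (u : R^nat) (l th : R) : 0 < th ->
  (forall n, 0 <= u n) -> u @ \oo --> l -> u n `^ th @[n --> \oo] --> l `^ th.
Proof.
move=> th0 u0 ul.
have : 0 <= l.
  by rewrite -(cvg_lim _ ul)//; apply: limr_ge; [apply/cvg_ex; exists l|exact: nearW].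
rewrite le_eqVlt => /predU1P[l0|l0].
  rewrite -l0 in ul *; rewrite powR0 ?gt_eqF//.
  apply/cvgrPdist_lt => e e0; near=> n.
  rewrite sub0r normrN ger0_norm ?powR_ge0//.
  rewrite -[ltRHS](@powRr1 _ e) ?ltW// -(mulVf (lt0r_neq0 th0)) powRrM.
  rewrite gt0_ltr_powR ?nnegrE ?powR_ge0//.
  near: n; apply: cvgr_lt ul _ _; exact: powR_gt0.
have cl : {for l, continuous (fun x : R => x `^ th)}.
  apply: (@differentiable_continuous R R^o R^o).
  by apply/derivable1_diffP/derivable_powR; rewrite in_itv/= l0.
exact: (continuous_cvg _ cl ul).
Unshelve. all: by end_near. Qed.

Lemma cvg_gmean {I : finType} (theta : I -> R) (z : nat -> I -> R) (l : I -> R) :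
  (forall j, 0 < theta j) -> (forall n j, 0 <= z n j) ->
  (forall j, z n j @[n --> \oo] --> l j) ->
  gmean theta (z n) @[n --> \oo] --> gmean theta l.
Proof.
move=> t0 z0 zl; rewrite /gmean.
apply: cvg_big => [|j _]; first by move=> x; exact: mul_continuous.
exact: cvg_powR.
Qed.

(** The first variation of the mean in its j-th entry, without a derivative to
pass to the limit in: the entry moves from z j to c j = (1 - t) z j + t b, and
the concave function x^theta_j lies below its tangent at the new point c j. *)
Lemma gmean_variation {I : finType} (theta z c : I -> R) (j : I) (t b : R) :
  0 < theta j < 1 \/ theta j = 1 -> (forall i, 0 <= z i) -> 0 <= b ->
  0 < t < 1 ->
  c j = (1 - t) * z j + t * b -> (forall i, i != j -> c i = z i) ->
  gmean theta z + theta j * t * (gmean theta c / c j * b) <=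
  gmean theta c * (1 + theta j * t / (1 - t)).
Proof.
move=> th01 z0 b0 /andP[t0 t1] cj cz.
have t1' : 0 < 1 - t by rewrite subr_gt0.
have th0 : 0 < theta j by case: th01 => [/andP[]//|->].
rewrite /gmean (bigD1 j)//= [X in _ + _ * (X / _ * _)](bigD1 j)//=.
rewrite [X in _ <= X * _](bigD1 j)//=.
under [X in _ + _ * (_ * X / _ * _)]eq_bigr => i ij do rewrite cz//.
under [X in _ <= _ * X * _]eq_bigr => i ij do rewrite cz//.
set P := \prod_(_ | _) _.
have P0 : 0 <= P by apply: prodr_ge0 => i _; exact: powR_ge0.
move: (c j) (z j) (theta j) (z0 j) th0 th01 cj => {cz} c a th a0 th0 th01 cE.
have := addr_ge0 (mulr_ge0 (ltW t1') a0) (mulr_ge0 (ltW t0) b0).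
rewrite -cE le_eqVlt => /predU1P[c0|c0].
  have az : a = 0.
    have : 0 <= (1 - t) * a /\ 0 <= t * b by rewrite !mulr_ge0// ltW.
    move=> [aa bb]; have /eqP : (1 - t) * a = 0 by lra.
    by rewrite mulf_eq0 gt_eqF//= => /eqP.
  by rewrite -c0 invr0 !mulr0 mul0r mulr0 addr0 az !powR0 ?gt_eqF// !mul0r.
have tan : a `^ th <= c `^ th * (1 + th * (a / c - 1)).
  have ac0 : 0 <= a / c := divr_ge0 a0 (ltW c0).
  have {1}-> : a = c * (a / c) by rewrite mulrCA divff ?mulr1// gt_eqF.
  rewrite (powRM _ (ltW c0) ac0) ler_pM2l ?powR_gt0//.
  by case: th01 => [?|->]; [exact: powR_le_affine|rewrite powRr1//; lra].
apply: (@le_trans _ _ (P * c `^ th * (1 + th * (a / c - 1) + th * (t * b / c)))).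
  rewrite [leRHS](_ : _ = (c `^ th * (1 + th * (a / c - 1))) * P +
    th * t * (c `^ th * P / c * b)); last by ring.
  by rewrite lerD2r ler_wpM2r.
rewrite [P * _]mulrC ler_wpM2l ?mulr_ge0 ?powR_ge0//.
rewrite (_ : t * b = c - (1 - t) * a); last by rewrite cE; ring.
rewrite mulrBl divff ?gt_eqF//.
have ac : a / c <= (1 - t)^-1.
  rewrite ler_pdivrMr// ler_pdivlMl// cE lerDl mulr_ge0//; exact: ltW.
have := ler_wpM2l (ltW (mulr_gt0 th0 t0)) ac; rewrite -[(1 - t) * a / c]mulrA.
by move: (a / c) ((1 - t)^-1) => x y; lra.
Qed.

End power_limits.

(** * Almost everywhere limits of nonnegative functions *)

Section nonnegative_integrals.
Context {R : realType} {d : measure_display} {X : measurableType d}.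
Variable mu : {measure set X -> \bar R}.
Implicit Types f g : X -> R.

Lemma le_integral_EFin f g : measurable_fun [set: X] f ->
  measurable_fun [set: X] g -> (forall x, 0 <= f x) -> (forall x, 0 <= g x) ->
  {ae mu, forall x, f x <= g x} ->
  (\int[mu]_x (f x)%:E <= \int[mu]_x (g x)%:E)%E.
Proof.
move=> mf mg f0 g0 fg; apply: ae_ge0_le_integral => //.
- by move=> x _; rewrite lee_fin.
- exact/measurable_EFinP.
- by move=> x _; rewrite lee_fin.
- exact/measurable_EFinP.
- by apply: filterS fg => x + _; rewrite lee_fin.
Qed.

Lemma integralD_nneg f g : measurable_fun [set: X] f ->
  measurable_fun [set: X] g -> (forall x, 0 <= f x) -> (forall x, 0 <= g x) ->
  (\int[mu]_x (f x + g x)%:E = \int[mu]_x (f x)%:E + \int[mu]_x (g x)%:E)%E.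
Proof.
move=> mf mg f0 g0; under eq_integral do rewrite EFinD.
rewrite ge0_integralD//; first [exact/measurable_EFinP|
  by move=> x _; rewrite lee_fin|idtac].
Qed.

Lemma integralZ_nneg (k : R) f : measurable_fun [set: X] f ->
  (forall x, 0 <= f x) -> 0 <= k ->
  (\int[mu]_x (k * f x)%:E = k%:E * \int[mu]_x (f x)%:E)%E.
Proof.
move=> mf f0 k0; under eq_integral do rewrite EFinM.
rewrite ge0_integralZl_EFin//; first [exact/measurable_EFinP|
  by move=> x _; rewrite lee_fin|idtac].
Qed.

Lemma ae_forall_countable (I : countType) (P : I -> X -> Prop) :
  (forall i, {ae mu, forall x, P i x}) -> {ae mu, forall x, forall i, P i x}.
Proof.
move=> aeP.
pose Q n x := if @unpickle I n is Some i then P i x else True.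
have : {ae mu, forall x, forall n, Q n x}.
  apply: ae_foralln => n; rewrite /Q; case: unpickle => // ; exact: aeW.
by apply: filterS => x Qx i; have := Qx (pickle i); rewrite /Q pickleK.
Qed.

Lemma measurable_limn_einf (f_ : nat -> X -> R) :
  (forall n, measurable_fun [set: X] (f_ n)) ->
  measurable_fun [set: X] (fun x => limn_einf (fun n => (f_ n x)%:E)).
Proof.
move=> mf; apply: measurableT_comp => //.
apply: measurable_fun_limn_esup => n; apply: (@measurableT_comp _ _ _ _ _ _ -%E) => //.
exact/measurable_EFinP.
Qed.

Lemma cvgn_EFin (u : R^nat) (l : R) :
  u @ \oo --> l -> (u n)%:E @[n --> \oo] --> l%:E.
Proof. by move=> ul; apply: cvg_EFin => //; exact: nearW. Qed.

Lemma limn_einf_ge0 (u : R^nat) : (forall n, 0 <= u n) ->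
  (0 <= limn_einf (EFin \o u))%E.
Proof.
move=> u0; rewrite limn_einf_lim; apply: lime_ge; first exact: is_cvg_einfs.
by apply: nearW => n; apply: le_ereal_inf_tmp => _ [k _ <-]; rewrite lee_fin.
Qed.

Lemma fatou_cvg (f_ : nat -> X -> R) f (c_ : R^nat) (c : R) :
  (forall n, measurable_fun [set: X] (f_ n)) -> (forall n x, 0 <= f_ n x) ->
  measurable_fun [set: X] f -> (forall x, 0 <= f x) ->
  {ae mu, forall x, f_ n x @[n --> \oo] --> f x} ->
  (forall n, \int[mu]_x (f_ n x)%:E <= (c_ n)%:E)%E -> c_ @ \oo --> c ->
  (\int[mu]_x (f x)%:E <= c%:E)%E.
Proof.
move=> mf f0 mF F0 fF fc cc.
have mEf n : measurable_fun [set: X] (EFin \o f_ n) by exact/measurable_EFinP.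
have Ef0 n x : [set: X] x -> (0 <= (EFin \o f_ n) x)%E by rewrite lee_fin.
have fat := fatou mu measurableT mEf Ef0.
have -> : (\int[mu]_x (f x)%:E = \int[mu]_x limn_einf (fun n => (f_ n x)%:E))%E.
  apply: ge0_ae_eq_integral => //.
  - exact/measurable_EFinP.
  - exact: measurable_limn_einf.
  - by move=> x _; rewrite lee_fin.
  - by move=> x _; exact: limn_einf_ge0.
  - apply: filterS fF => x fx _; apply/esym.
    by have [-> _] := cvg_limn_einf_sup (cvgn_EFin fx).
apply: le_trans fat _; rewrite limn_einf_lim.
have cE := cvgn_EFin cc.
rewrite -(cvg_lim _ cE)//; apply: lee_lim.
- exact: is_cvg_einfs.
- by apply/cvg_ex; exists c%:E.
- apply: nearW => n; apply: le_trans (fc n).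
  by apply: ereal_inf_lbound; exists n => /=.
Qed.

Lemma ae_not_pinfty (f_ : nat -> X -> R) (C : R) :
  (forall n, measurable_fun [set: X] (f_ n)) -> (forall n x, 0 <= f_ n x) ->
  (forall n, \int[mu]_x (f_ n x)%:E <= C%:E)%E ->
  {ae mu, forall x, ~ (f_ n x @[n --> \oo] --> +oo)}.
Proof.
move=> mf f0 fC.
have mEf n : measurable_fun [set: X] (EFin \o f_ n) by exact/measurable_EFinP.
have Ef0 n x : [set: X] x -> (0 <= (EFin \o f_ n) x)%E by rewrite lee_fin.
have fat := fatou mu measurableT mEf Ef0.
have ile : (\int[mu]_x limn_einf (fun n => (f_ n x)%:E) <= C%:E)%E.
  apply: le_trans fat _; rewrite limn_einf_lim.
  apply: lime_le; first exact: is_cvg_einfs.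
  apply: nearW => n; apply: le_trans (fC n).
  by apply: ereal_inf_lbound; exists n => /=.
have : mu.-integrable [set: X] (fun x => limn_einf (fun n => (f_ n x)%:E)).
  apply/integrableP; split.
    exact: measurable_limn_einf.
  apply: le_lt_trans (ltry C); apply: le_trans ile.
  rewrite le_eqVlt; apply/orP; left; apply/eqP.
  by apply: eq_integral => x _; rewrite gee0_abs//; exact: limn_einf_ge0.
move=> /(integrable_ae measurableT); apply: filterS => x /(_ I) + fx.
have fy : (f_ n x)%:E @[n --> \oo] --> +oo%E.
  by apply/cvgeryP.
by have [-> _] := cvg_limn_einf_sup fy.
Qed.

(** A measurable function equal to the limit wherever the sequence converges;
elsewhere its value is arbitrary but nonnegative for nonnegative sequences. *)
Definition limfun (f_ : nat -> X -> R) x : R :=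
  fine (limn_esup (fun n => (f_ n x)%:E)).

Lemma measurable_limfun (f_ : nat -> X -> R) :
  (forall n, measurable_fun [set: X] (f_ n)) ->
  measurable_fun [set: X] (limfun f_).
Proof.
move=> mf; apply: measurableT_comp => //.
by apply: measurable_fun_limn_esup => n; exact/measurable_EFinP.
Qed.

Lemma limfunE (f_ : nat -> X -> R) x l :
  f_ n x @[n --> \oo] --> l -> limfun f_ x = l.
Proof.
move=> fl; rewrite /limfun.
by have [_ ->] := cvg_limn_einf_sup (cvgn_EFin fl).
Qed.

Lemma limfun_ge0 (f_ : nat -> X -> R) x : (forall n, 0 <= f_ n x) ->
  0 <= limfun f_ x.
Proof.
move=> f0; apply: fine_ge0; rewrite limn_esup_lim.
apply: lime_ge; first exact: is_cvg_esups.
apply: nearW => n; apply: (@le_trans _ _ (f_ n x)%:E); first by rewrite lee_fin.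
by apply: ereal_sup_ubound; exists n => /=.
Qed.

Lemma ae_summable (g : nat -> X -> R) (c : R^nat) (C : R) :
  (forall n, measurable_fun [set: X] (g n)) -> (forall n x, 0 <= g n x) ->
  (forall n, \int[mu]_x (g n x)%:E <= (c n)%:E)%E ->
  (forall n, \sum_(0 <= i < n) c i <= C) ->
  {ae mu, forall x, cvgn (series (fun n => g n x))}.
Proof.
move=> mg g0 gc cC.
have : {ae mu, forall x, ~ (\sum_(0 <= i < n) g i x @[n --> \oo] --> +oo)}.
  apply: (@ae_not_pinfty _ C) => [n|n x|n].
  - exact: measurable_sum.
  - exact: sumr_ge0.
  - under eq_integral do rewrite -sumEFin.
    rewrite ge0_integral_sum//.
    + by apply: le_trans (lee_sum _ (fun k _ => gc k)) _; rewrite sumEFin lee_fin.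
    + by move=> k; exact/measurable_EFinP.
    + by move=> k x _; rewrite lee_fin.
apply: filterS => x; apply: contra_notP => ncv.
apply: nondecreasing_dvgn_lt => //.
apply/nondecreasing_seqP => n.
by rewrite big_nat_recr//= lerDl.
Qed.

(** The density is the sum of multiples of indicators of sets of finite measure
that cover the space, with coefficients making both the function and its
integral at most 1. *)
Lemma sigma_finite_density : sigma_finite [set: X] mu ->
  exists rho : X -> R, [/\ measurable_fun [set: X] rho,
    forall x, 0 < rho x <= 1 & (\int[mu]_x (rho x)%:E < +oo)%E].
Proof.
move=> [F UF mF].
pose a n : R := 2^-1 ^+ n.+1 / (1 + fine (mu (F n))).
have fF n : 0 <= fine (mu (F n)) by apply: fine_ge0.
have a0 n : 0 < a n by rewrite divr_gt0 ?exprn_gt0// ltr_wpDr.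
pose s n x := \sum_(0 <= i < n) a i * \1_(F i) x.
have half n : \sum_(0 <= i < n) 2^-1 ^+ i.+1 = 1 - 2^-1 ^+ n :> R.
  elim: n => [|n ih]; first by rewrite big_nil expr0 subrr.
  by rewrite big_nat_recr//= ih exprS; lra.
have s_le1 n x : s n x <= 1.
  apply: (@le_trans _ _ (\sum_(0 <= i < n) 2^-1 ^+ i.+1)).
    apply: ler_sum => i _; rewrite -[leRHS]mulr1; apply: ler_pM.
    - exact: ltW.
    - by rewrite indicE.
    - by rewrite ler_pdivrMr ?ltr_wpDr// ler_peMr ?exprn_ge0// lerDl.
    - by rewrite indicE; case: (_ \in _).
  by rewrite half lerBlDr lerDl exprn_ge0.
have s_nd x : nondecreasing_seq (s ^~ x).
  apply/nondecreasing_seqP => n; rewrite /s big_nat_recr//= lerDl.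
  by rewrite mulr_ge0// ltW.
have s_cvg x : s n x @[n --> \oo] --> limfun s x.
  have : cvgn (s ^~ x).
    apply: nondecreasing_is_cvgn => //.
    by exists 1 => _ [n _ <-].
  by move=> /cvg_ex[l sl]; rewrite (limfunE sl).
have ms n : measurable_fun [set: X] (s n).
  apply: measurable_sum => i; apply: measurable_funM => //.
  by apply: measurable_indic; exact: (mF i).1.
exists (limfun s); split.
- exact: measurable_limfun.
- move=> x; apply/andP; split; last first.
    by rewrite -(cvg_lim _ (s_cvg x))//; apply: limr_le;
      [apply/cvg_ex; exists (limfun s x)|exact: nearW].
  have [n _ Fx] : (\bigcup_i F i) x by rewrite -UF.
  apply: (@lt_le_trans _ _ (s n.+1 x)).
    rewrite /s big_nat_recr//= ltr_wpDl ?sumr_ge0//.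
      by move=> i _; rewrite mulr_ge0// ltW.
    by rewrite mulr_gt0// indicE mem_set.
  rewrite -(cvg_lim _ (s_cvg x))//; apply: limr_ge.
    by apply/cvg_ex; exists (limfun s x).
  by exists n.+1 => //= m /= nm; exact: s_nd.
- apply: le_lt_trans (ltry 1).
  apply: (@fatou_cvg s _ (fun=> 1)) => //.
  + by move=> n x; apply: sumr_ge0 => i _; rewrite mulr_ge0// ltW.
  + exact: measurable_limfun.
  + move=> x; apply: limfun_ge0 => n.
    by apply: sumr_ge0 => i _; rewrite mulr_ge0// ltW.
  + by apply: aeW => x; exact: s_cvg.
  + move=> n; rewrite /s; under eq_integral do rewrite -sumEFin.
    rewrite ge0_integral_sum//; first last.
    * by move=> k x _; rewrite lee_fin mulr_ge0// ltW.
    * move=> k; apply/measurable_EFinP; apply: measurable_funM => //.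
      by apply: measurable_indic; exact: (mF k).1.
    apply: (@le_trans _ _ (\sum_(0 <= i < n) (2^-1 ^+ i.+1)%:E)%E).
      apply: lee_sum => i _.
      rewrite integralZ_nneg//; last first.
      * exact: ltW.
      * by apply: measurable_indic; exact: (mF i).1.
      rewrite integral_indic//; last exact: (mF i).1.
      rewrite setIT -(@fineK _ (mu (F i))); last first.
        by rewrite ge0_fin_numE//; exact: (mF i).2.
      rewrite -EFinM lee_fin mulrAC ler_pdivrMr ?ltr_wpDr//.
      by rewrite ler_wpM2l ?exprn_ge0// lerDr.
    by rewrite sumEFin lee_fin half lerBlDr lerDl exprn_ge0.
  + exact: cvg_cst.
Qed.
End nonnegative_integrals.

(** * Convergent selections from convex families *)

Section forward_convex_compactness.
Context {R : realType} {d : measure_display} {X : measurableType d}.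
Variable mu : {measure set X -> \bar R}.

Definition fcomb {I : Type} (t : R) (f g : I -> X -> R) : I -> X -> R :=
  fun j x => (1 - t) * f j x + t * g j x.

Definition convex_family {I : Type} (S : set (I -> X -> R)) :=
  forall t f g, 0 <= t <= 1 -> S f -> S g -> S (fcomb t f g).

Section entropy.
Variables (rho : X -> R).
Implicit Types f g : X -> R.
Hypothesis mrho : measurable_fun [set: X] rho.
Hypothesis rho01 : forall x, 0 < rho x <= 1.
Hypothesis irho : (\int[mu]_x (rho x)%:E < +oo)%E.

(** A strictly convex functional that is bounded on nonnegative functions and
insensitive to large values; its minimisation replaces a compactness argument. *)
Definition expint (f : X -> R) : R :=
  fine (\int[mu]_x (rho x * expR (- f x))%:E)%E.

Let rho0 x : 0 < rho x. Proof. by have /andP[] := rho01 x. Qed.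

Let mexp (f : X -> R) : measurable_fun [set: X] f ->
  measurable_fun [set: X] (fun x => rho x * expR (- f x)).
Proof.
move=> mf; apply: measurable_funM => //; apply: measurableT_comp => //.
exact: measurableT_comp.
Qed.

Lemma expint_le f : measurable_fun [set: X] f -> (forall x, 0 <= f x) ->
  (\int[mu]_x (rho x * expR (- f x))%:E <= \int[mu]_x (rho x)%:E)%E.
Proof.
move=> mf f0; apply: le_integral_EFin => //.
- exact: mexp.
- by move=> x; rewrite mulr_ge0 ?expR_ge0// ltW.
- by move=> x; exact: ltW.
- apply: aeW => x; rewrite ler_piMr ?(ltW (rho0 x))//.
  by rewrite -expR0 ler_expR oppr_le0.
Qed.

Lemma expint_fin f : measurable_fun [set: X] f -> (forall x, 0 <= f x) ->
  (\int[mu]_x (rho x * expR (- f x))%:E \is a fin_num)%E.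
Proof.
move=> mf f0; rewrite ge0_fin_numE; last first.
  by apply: integral_ge0 => x _; rewrite lee_fin mulr_ge0 ?expR_ge0// ltW.
exact: le_lt_trans (expint_le mf f0) irho.
Qed.

Lemma expint_ge0 f : 0 <= expint f.
Proof.
apply: fine_ge0; apply: integral_ge0 => x _.
by rewrite lee_fin mulr_ge0 ?expR_ge0// ltW.
Qed.

Lemma expint_ub f : measurable_fun [set: X] f -> (forall x, 0 <= f x) ->
  expint f <= fine (\int[mu]_x (rho x)%:E)%E.
Proof.
move=> mf f0; apply: fine_le; [exact: expint_fin| |exact: expint_le].
rewrite ge0_fin_numE//; apply: integral_ge0 => x _.
by rewrite lee_fin ltW.
Qed.

(** With a = exp(- f / 2) and b = exp(- g / 2) the integrand on the left is
rho (a^2 + b^2 - 2 a b): the midpoint defect of exp(- f) is an exact square, so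
functions that almost minimise over a convex family are close to each other. *)
Lemma expint_gap f g : measurable_fun [set: X] f -> measurable_fun [set: X] g ->
  (forall x, 0 <= f x) -> (forall x, 0 <= g x) ->
  (\int[mu]_x (rho x * (expR (- (f x / 2)) - expR (- (g x / 2))) ^+ 2)%:E =
   (expint f + expint g -
    2 * expint (fun x => (1 - 2^-1) * f x + 2^-1 * g x))%:E)%E.
Proof.
move=> mf mg f0 g0.
set h := fun x => (1 - 2^-1) * f x + 2^-1 * g x.
have mh : measurable_fun [set: X] h.
  by apply: measurable_funD; exact: measurable_funM.
have h0 x : 0 <= h x.
  by have := f0 x; have := g0 x; rewrite /h; lra.
have ms : measurable_fun [set: X]
    (fun x => rho x * (expR (- (f x / 2)) - expR (- (g x / 2))) ^+ 2).
  apply: measurable_funM => //; apply: measurable_funX.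
  apply: measurable_funB; apply: measurableT_comp => //;
    apply: measurableT_comp => //; exact: measurable_funM.
have s0 x : 0 <= rho x * (expR (- (f x / 2)) - expR (- (g x / 2))) ^+ 2.
  by rewrite mulr_ge0 ?sqr_ge0// ltW.
have E : (\int[mu]_x (rho x * (expR (- (f x / 2)) - expR (- (g x / 2))) ^+ 2)%:E
    + 2%:E * (expint h)%:E = (expint f)%:E + (expint g)%:E)%E.
  rewrite !fineK ?expint_fin//.
  have e0 k x : 0 <= rho x * expR (- k x) by rewrite mulr_ge0 ?expR_ge0// ltW.
  rewrite -integralZ_nneg//; last exact: mexp.
  rewrite -!integralD_nneg//;
    try exact: mexp; try by [move=> x; rewrite mulr_ge0// e0|
      apply: measurable_funM => //; exact: mexp].
  apply: eq_integral => x _; congr EFin.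
  have -> : - h x = - (f x / 2) + - (g x / 2) by rewrite /h; field.
  have -> : - f x = - (f x / 2) + - (f x / 2) by field.
  have -> : - g x = - (g x / 2) + - (g x / 2) by field.
  by rewrite !expRD; ring.
have : (0 <= \int[mu]_x (rho x *
    (expR (- (f x / 2)) - expR (- (g x / 2))) ^+ 2)%:E)%E.
  by apply: integral_ge0 => x _; rewrite lee_fin.
move: E; case: (integral _ _ _) => [r||]//.
by move=> [] E _; congr EFin; lra.
Qed.

End entropy.

Lemma expR_cvg_dichotomy (f : R^nat) : (forall n, 0 <= f n) ->
  cvgn (fun n => expR (- (f n / 2))) ->
  (exists l : R, f @ \oo --> l) \/ f @ \oo --> +oo.
Proof.
move=> f0 /cvg_ex[/= H hH].
have : 0 <= H.
  rewrite -(cvg_lim _ hH)//; apply: limr_ge; first by apply/cvg_ex; exists H.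
  by apply: nearW => n; exact: expR_ge0.
have fE n : f n = - 2 * ln (expR (- (f n / 2))) by rewrite expRK; field.
rewrite le_eqVlt => /predU1P[H0|H0]; [right|left].
- apply/cvgryPge => A.
  have : \forall n \near \oo, expR (- (f n / 2)) < expR (- (A / 2)).
    by apply: cvgr_lt hH _ _; rewrite -H0 expR_gt0.
  by apply: filterS => n; rewrite ltr_expR; lra.
- exists (- 2 * ln H); rewrite (_ : f = fun n => - 2 * ln (expR (- (f n / 2)))).
    by apply: cvgMr => //; exact: (continuous_cvg _ (continuous_ln H0) hH).
  by apply/funext.
Qed.

(** Let J be the sum over j of the integrals of rho exp(- f_j).  The infima of J
over the families S n increase to a finite limit L.  Choose the n-th function
with J within 4^-n of L, in a family on which J is at least L - 4^-n.  By
[expint_gap] consecutive functions exp(- f_n / 2) then differ by at most a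
multiple of 2^-n in the weighted L^2 norm, which makes the sequence of these
functions converge almost everywhere, to a limit that may be 0. *)
Lemma forward_convex_compactness {I : finType} (S : nat -> set (I -> X -> R)) :
  sigma_finite [set: X] mu ->
  (forall n f, S n f ->
    forall j, measurable_fun [set: X] (f j) /\ forall x, 0 <= f j x) ->
  (forall m n, (m <= n)%N -> S n `<=` S m) -> (forall n, S n !=set0) ->
  (forall n, convex_family (S n)) ->
  exists2 f_ : nat -> I -> X -> R, forall n, S n (f_ n) &
    {ae mu, forall x, forall j,
      (exists l : R, f_ n j x @[n --> \oo] --> l) \/
      f_ n j x @[n --> \oo] --> +oo}.
Proof.
move=> sf Smeas Sdecr Sne Sconv.
have [rho [mrho rho01 irho]] := sigma_finite_density sf.
have rho0 x : 0 < rho x by have /andP[] := rho01 x.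
pose J f := \sum_(j : I) expint rho (f j).
pose C := \sum_(j : I) fine (\int[mu]_x (rho x)%:E)%E.
have J0 f : 0 <= J f by apply: sumr_ge0 => j _; exact: expint_ge0.
have JC n f : S n f -> J f <= C.
  move=> Sf; apply: ler_sum => j _; have [mf f0] := Smeas _ _ Sf j.
  exact: expint_ub.
pose i n := inf (J @` S n).
have iJ n f : S n f -> i n <= J f.
  move=> Sf; apply: ge_inf; last by exists f.
  by exists 0 => _ [g _ <-]; exact: J0.
have iC n : i n <= C.
  by have [f Sf] := Sne n; exact: le_trans (iJ _ _ Sf) (JC _ _ Sf).
pose L := sup (range i).
have hsL : has_sup (range i).
  by split; [exists (i 0%N), 0%N|exists C => _ [n _ <-]].
have iL n : i n <= L by apply: sup_upper_bound => //; exists n.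
have i_nd m n : (m <= n)%N -> i m <= i n.
  move=> mn; apply: lb_le_inf.
    by have [f Sf] := Sne n; exists (J f), f.
  by move=> _ [f Sf <-]; apply: iJ; exact: (Sdecr _ _ mn).
pose e k : R := 4^-1 ^+ k.
have e0 k : 0 < e k by rewrite exprn_gt0.
(* the pair holds the index of a family and a member of it *)
have ex k : exists nf : nat * (I -> X -> R), [/\ (k <= nf.1)%N, S nf.1 nf.2,
    J nf.2 < L + e k & L - e k < i nf.1].
  have [_ [n _ <-] Ln] := sup_adherent (e0 k) hsL.
  have Lm : L - e k < i (maxn k n) by apply: lt_le_trans Ln (i_nd _ _ (leq_maxr _ _)).
  have hi : has_inf (J @` S (maxn k n)).
    split; first by have [f Sf] := Sne (maxn k n); exists (J f), f.
    by exists 0 => _ [g _ <-]; exact: J0.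
  have [_ [f Sf <-] Jf] := inf_adherent (e0 k) hi.
  exists (maxn k n, f); split => //=; first exact: leq_maxl.
  by apply: lt_le_trans Jf _; rewrite lerD2r; exact: iL.
have /choice[nf nfP] := ex.
pose f_ k := (nf k).2.
have Sf k : S k (f_ k) by have [kn Snf _ _] := nfP k; exact: Sdecr kn _ Snf.
have mf k j : measurable_fun [set: X] (f_ k j) by exact: (Smeas _ _ (Sf k) j).1.
have f0 k j x : 0 <= f_ k j x by exact: (Smeas _ _ (Sf k) j).2.
exists f_ => //.
pose h k j x := expR (- (f_ k j x / 2)).
have gap k j : (\int[mu]_x (rho x * (h k j x - h k.+1 j x) ^+ 2)%:E
    <= (4 * e k)%:E)%E.
  rewrite /h (expint_gap mrho rho01 irho)// lee_fin.
  pose G j := expint rho (f_ k j) + expint rho (f_ k.+1 j)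
    - 2 * expint rho (fcomb 2^-1 (f_ k) (f_ k.+1) j).
  have G0 i' : 0 <= G i'.
    rewrite -lee_fin -(expint_gap mrho rho01 irho)//.
    by apply: integral_ge0 => x _; rewrite lee_fin mulr_ge0 ?sqr_ge0// ltW.
  apply: (@le_trans _ _ (\sum_j G j)).
    by rewrite (bigD1 j)//= lerDl sumr_ge0.
  rewrite sumrB big_split/= -mulr_sumr.
  have [kn Sn Jn Ln] := nfP k; have [kn' Sn' Jn' Ln'] := nfP k.+1.
  have ek : e k.+1 <= e k by rewrite /e exprS ger_pMl ?exprn_gt0//; lra.
  have : L - e k < J (fcomb 2^-1 (f_ k) (f_ k.+1)).
    have h01 : 0 <= (2^-1 : R) <= 1 by lra.
    have [nn|/ltnW nn] := leqP (nf k).1 (nf k.+1).1.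
      apply: lt_le_trans Ln (iJ _ _ _); apply: Sconv => //.
      exact: Sdecr nn _ Sn'.
    apply: lt_le_trans (iJ (nf k.+1).1 _ _); first by apply: le_lt_trans Ln'; lra.
    by apply: Sconv => //; exact: Sdecr nn _ Sn.
  by move: Jn Jn'; rewrite /J -/(f_ k) -/(f_ k.+1); lra.
have sumc j : {ae mu, forall x,
    cvgn (series (fun k => 2 ^+ k * (rho x * (h k j x - h k.+1 j x) ^+ 2)))}.
  have mh k : measurable_fun [set: X] (h k j).
    apply: measurableT_comp => //; apply: measurableT_comp => //.
    exact: measurable_funM.
  apply: (@ae_summable _ _ _ _ _ (fun k => 4 * 2^-1 ^+ k) 8) => [k|k x|k|n].
  - apply: measurable_funM => //; apply: measurable_funM => //.
    by apply: measurable_funX; exact: measurable_funB.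
  - by rewrite mulr_ge0 ?exprn_ge0// mulr_ge0 ?sqr_ge0// ltW.
  - rewrite integralZ_nneg ?exprn_ge0//; last 2 first.
    + apply: measurable_funM => //.
      by apply: measurable_funX; exact: measurable_funB.
    + by move=> x; rewrite mulr_ge0 ?sqr_ge0// ltW.
    apply: le_trans (lee_wpmul2l _ (gap k j)) _.
      by rewrite lee_fin exprn_ge0.
    rewrite -EFinM lee_fin /e mulrCA -exprMn le_eqVlt; apply/orP; left.
    by apply/eqP; congr (_ * _ ^+ _); lra.
  - rewrite -mulr_sumr.
    have -> : \sum_(0 <= k < n) 2^-1 ^+ k = 2 - 2 * 2^-1 ^+ n :> R.
      elim: n => [|n ih]; first by rewrite big_nil expr0; lra.
      by rewrite big_nat_recr//= ih exprS; lra.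
    have : 0 <= 2^-1 ^+ n :> R by rewrite exprn_ge0.
    by lra.
have := ae_forall_countable sumc; apply: filterS => x cvx j.
apply: expR_cvg_dichotomy => //.
suff : cvgn (series (fun k => h k.+1 j x - h k j x)).
  have -> : series (fun k => h k.+1 j x - h k j x) = fun n => h n j x - h 0%N j x.
    by apply/funext => n; rewrite /series/= telescope_sumr.
  move=> hc; rewrite (_ : (fun _ => _) =
    (fun n => h n j x - h 0%N j x) + cst (h 0%N j x)).
    by apply: is_cvgD hc _; exact: is_cvg_cst.
  by apply/funext => n; rewrite /= fctE/= subrK.
apply: normed_cvg.
have {}cvx := cvx j.
(* |y| <= 2^n y^2 + 2^-n turns the summability of the weighted squares into
   absolute convergence *)
apply: (@series_le_cvg _ _ (fun k => (rho x)^-1 *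
  (2 ^+ k * (rho x * (h k j x - h k.+1 j x) ^+ 2)) + 2^-1 ^+ k)).
- by move=> n /=.
- move=> n; rewrite addr_ge0 ?exprn_ge0// mulr_ge0 ?invr_ge0 ?(ltW (rho0 x))//.
  by rewrite mulr_ge0 ?exprn_ge0// mulr_ge0 ?sqr_ge0// ltW.
- move=> n /=; set D := (_ - _) ^+ 2.
  rewrite [_ * (rho x * D)]mulrCA mulKf ?gt_eqF//.
  have -> : D = `|h n.+1 j x - h n j x| ^+ 2 by rewrite /D real_normK ?num_real// sqrrB; ring.
  move: `|_| (normr_ge0 (h n.+1 j x - h n j x)) => y y0.
  have [p p0] : exists p : R, p = 2 ^+ n by exists (2 ^+ n).
  have pgt0 : 0 < p by rewrite p0 exprn_gt0.
  rewrite exprVn -p0.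
  have : 0 <= (p * y - 1) ^+ 2 / p by rewrite divr_ge0 ?sqr_ge0// ltW.
  have -> : (p * y - 1) ^+ 2 / p = p * y ^+ 2 - 2 * y + p^-1.
    by field; rewrite gt_eqF.
  by lra.
- rewrite (_ : series _ = (fun n => (rho x)^-1 *
      series (fun k => 2 ^+ k * (rho x * (h k j x - h k.+1 j x) ^+ 2)) n)
      + series (fun k => 2^-1 ^+ k)); last first.
    apply/funext => n; rewrite fctE /series/= big_split/=.
    by rewrite mulr_sumr.
  apply: is_cvgD; first exact: is_cvgMr.
  by have := @is_cvg_geometric_series R 1 2^-1; rewrite /geometric; under [X in series X]eq_fun do rewrite mul1r; apply; rewrite ger0_norm; lra.
Qed.

End forward_convex_compactness.

(** * Disentanglement for convex sets of functions *)

Section disentanglement.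
Context {R : realType} {d : measure_display} {X : measurableType d}.
Variable mu : {measure set X -> \bar R}.
Context {I : finType}.
Variable theta : I -> R.
Hypothesis theta_gt0 : forall j, 0 < theta j.
Hypothesis theta_sum : \sum_j theta j = 1.

Lemma measurable_gmean (z : I -> X -> R) :
  (forall j, measurable_fun [set: X] (z j)) ->
  measurable_fun [set: X] (fun x => gmean theta (z^~ x)).
Proof.
move=> mz; apply: measurable_prod => j _.
exact: (measurableT_comp (@measurable_powR R (theta j))).
Qed.

Lemma measurable_inv_nneg (f : X -> R) : measurable_fun [set: X] f ->
  (forall x, 0 <= f x) -> measurable_fun [set: X] (fun x => (f x)^-1).
Proof.
move=> mf f0; under eq_fun do rewrite -powR_inv1//.
exact: (measurableT_comp (@measurable_powR R (-1))).
Qed.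

Definition positivity_set (w : I -> X -> R) : set X :=
  [set x | forall j, 0 < w j x].

Lemma measurable_positivity_set (w : I -> X -> R) :
  (forall j, measurable_fun [set: X] (w j)) -> measurable (positivity_set w).
Proof.
move=> mw.
have -> : positivity_set w = \bigcap_(j in [set: I]) [set x | 0 < w j x].
  by apply/seteqP; split => [x wx j _|x wx j]; [exact: wx|exact: wx j Logic.I].
apply: fin_bigcap_measurable; first exact: finite_finset.
move=> j _.
have := measurable_fun_ltr (@measurable_cst _ _ X _ setT (0 : R)) (mw j).
move=> /(_ measurableT [set true]); rewrite setTI; apply.
by [].
Qed.

Lemma gmean_quotient (z : I -> R) : (forall j, 0 < z j) ->
  gmean theta (fun j => gmean theta z / z j) = 1.
Proof.
move=> z0; have G0 := gmean_gt0 theta z0.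
have q0 j : 0 <= gmean theta z / z j by rewrite divr_ge0// ltW.
apply: (mulfI (lt0r_neq0 G0)); rewrite mulr1 -gmeanM// => [|j]; last exact: ltW.
under [X in gmean _ X]eq_fun do rewrite mulrCA divff ?gt_eqF// mulr1.
exact: gmean_cst.
Qed.

Lemma theta_le1 j : 0 < theta j < 1 \/ theta j = 1.
Proof.
have : theta j <= 1.
  by rewrite -theta_sum (bigD1 j)//= lerDl sumr_ge0// => i _; exact: ltW.
by rewrite le_eqVlt => /predU1P[|tj]; [right|left; rewrite theta_gt0].
Qed.

(** Excludes infinite limits: means with bounded integrals almost nowhere tend
to infinity, and hence neither do their entries where these are bounded below by
positive numbers. *)
Lemma gmean_dvg (z : nat -> I -> R) (b : I -> R) (j : I) :
  (forall i, 0 < b i) -> (forall n i, b i <= z n i) ->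
  z n j @[n --> \oo] --> +oo -> gmean theta (z n) @[n --> \oo] --> +oo.
Proof.
move=> b0 bz /cvgryPge zy; apply/cvgryPge => A.
pose c := \prod_(i | i != j) b i `^ theta i.
have c0 : 0 < c by apply: prodr_gt0 => i _; exact: powR_gt0.
have := zy ((`|A| / c) `^ (theta j)^-1); apply: filterS => n zn.
rewrite /gmean (bigD1 j)//=.
apply: (@le_trans _ _ (`|A| / c * c)).
  by rewrite divfK ?gt_eqF// ler_norm.
apply: ler_pM; [by rewrite divr_ge0// ltW|exact: ltW| |].
- have A0 : 0 <= `|A| / c by rewrite divr_ge0// ltW.
  rewrite -[leLHS]powRr1// -(mulVf (lt0r_neq0 (theta_gt0 j))) powRrM.
  by apply: ge0_ler_powR; rewrite ?nnegrE ?powR_ge0 ?(ltW (theta_gt0 j))//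
    (le_trans _ zn)// powR_ge0.
- apply: ler_prod => i _; rewrite powR_ge0/=.
  have bi := ltW (b0 i).
  by apply: ge0_ler_powR; rewrite ?nnegrE ?(ltW (theta_gt0 i))//
    (le_trans bi (bz n i)).
Qed.

Variable K : I -> set (X -> R).
Hypothesis K_nneg : forall j u, K j u ->
  measurable_fun [set: X] u /\ forall x, 0 <= u x.
Hypothesis K_convex : forall j t u v, 0 <= t <= 1 -> K j u -> K j v ->
  K j (fun x => (1 - t) * u x + t * v x).
Variable B : R.
Hypothesis K_bound : forall u : I -> X -> R, (forall j, K j (u j)) ->
  (\int[mu]_x (gmean theta (u^~ x))%:E <= B%:E)%E.
Hypothesis mu_sf : sigma_finite [set: X] mu.

Section perturbed_maximiser.
Variables (w : I -> X -> R) (eps : R).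
Hypothesis Kw : forall j, K j (w j).
Hypothesis eps0 : 0 < eps.

Let PK : set (I -> X -> R) := [set u | forall j, K j (u j)].
Let z (u : I -> X -> R) j x : R := u j x + eps * w j x.
Let F u x : R := gmean theta ((z u)^~ x).
Let Phi u : R := fine (\int[mu]_x (F u x)%:E)%E.

Let mw j : measurable_fun [set: X] (w j). Proof. exact: (K_nneg (Kw j)).1. Qed.
Let w0 j x : 0 <= w j x. Proof. exact: (K_nneg (Kw j)).2. Qed.

Let mz u j : PK u -> measurable_fun [set: X] (z u j).
Proof.
move=> Ku; apply: measurable_funD; first exact: (K_nneg (Ku j)).1.
exact: measurable_funM.
Qed.

Let z0 u j x : PK u -> 0 <= z u j x.
Proof.
move=> Ku; rewrite addr_ge0 ?(K_nneg (Ku j)).2// mulr_ge0// ltW//.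
Qed.

Let mF u : PK u -> measurable_fun [set: X] (F u).
Proof. by move=> Ku; apply: measurable_gmean => j; exact: mz. Qed.

Let F0 u x : 0 <= F u x. Proof. exact: gmean_ge0. Qed.

(* u + eps w is 1 + eps times a convex combination of u and w *)
Let iF u : PK u -> (\int[mu]_x (F u x)%:E <= ((1 + eps) * B)%:E)%E.
Proof.
move=> Ku.
have e1 : 0 < 1 + eps by rewrite addr_gt0.
pose t := eps / (1 + eps).
have t01 : 0 <= t <= 1.
  by rewrite /t divr_ge0 ?(ltW eps0) ?(ltW e1)//= ler_pdivrMr// mul1r lerDr.
have Kc : PK (fun j x => (1 - t) * u j x + t * w j x).
  by move=> j; exact: K_convex.
have -> : (\int[mu]_x (F u x)%:E = \int[mu]_x ((1 + eps) *
    gmean theta (fun j => (1 - t) * u j x + t * w j x))%:E)%E.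
  apply: eq_integral => x _; congr EFin.
  rewrite -gmeanZ// ?(ltW e1)//; last by move=> j; exact: (K_nneg (Kc j)).2.
  rewrite /F/z; congr gmean; apply/funext => j; rewrite /t; field.
  by rewrite gt_eqF.
rewrite integralZ_nneg ?(ltW e1)//; last 2 first.
- by apply: measurable_gmean => j; exact: (K_nneg (Kc j)).1.
- by move=> x; exact: gmean_ge0.
by rewrite EFinM lee_pmul2l// K_bound.
Qed.

Let Phi_fin u : PK u -> (\int[mu]_x (F u x)%:E = (Phi u)%:E)%E.
Proof.
move=> Ku; rewrite fineK// ge0_fin_numE; first exact: le_lt_trans (iF Ku) (ltry _).
by apply: integral_ge0 => x _; rewrite lee_fin.
Qed.

Let Phi_ub u : PK u -> Phi u <= (1 + eps) * B.
Proof. by move=> Ku; rewrite -lee_fin -Phi_fin//; exact: iF. Qed.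

Let M := sup (Phi @` PK).

Let hsM : has_sup (Phi @` PK).
Proof.
split; first by exists (Phi w), w.
by exists ((1 + eps) * B) => _ [u Ku <-]; exact: Phi_ub.
Qed.

Let PhiM u : PK u -> Phi u <= M.
Proof. by move=> Ku; apply: sup_upper_bound => //; exists u. Qed.

Let MB : M <= (1 + eps) * B.
Proof.
by apply: ge_sup; [exact: hsM.1|move=> _ [u Ku <-]; exact: Phi_ub].
Qed.

(* any null sequence in ]0, 1[ serves *)
Let t n : R := harmonic n / 2.
Let t01 n : 0 < t n < 1.
Proof.
have h0 : 0 < harmonic n :> R by rewrite /= invr_gt0 ltr0n.
have h1 : harmonic n <= 1 :> R by rewrite /= invf_le1 ?ler1n// ltr0n.
by rewrite /t; move: (harmonic n) h0 h1 => y h0 h1; lra.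
Qed.

Let S n : set (I -> X -> R) := [set u | PK u /\ M - t n ^+ 2 <= Phi u].

Let Phi_concave (s : R) u v : 0 <= s <= 1 -> PK u -> PK v ->
  (1 - s) * Phi u + s * Phi v <= Phi (fcomb s u v).
Proof.
move=> s01 Ku Kv; have /andP[s0 s1] := s01.
have s'0 : 0 <= 1 - s by lra.
have Kc : PK (fcomb s u v) by move=> j; exact: K_convex.
suff : ((1 - s)%:E * \int[mu]_x (F u x)%:E + s%:E * \int[mu]_x (F v x)%:E <=
    \int[mu]_x (F (fcomb s u v) x)%:E)%E.
  by rewrite (Phi_fin Ku) (Phi_fin Kv) (Phi_fin Kc).
rewrite -!integralZ_nneg//; try exact: mF.
rewrite -integralD_nneg//; try by move=> x; rewrite mulr_ge0.
- apply: le_integral_EFin.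
  + by apply: measurable_funD; apply: measurable_funM => //; exact: mF.
  + exact: mF.
  + by move=> x; rewrite addr_ge0// mulr_ge0.
  + exact: F0.
  + apply: aeW => x; rewrite /F.
    have -> : (z (fcomb s u v))^~ x =
        fun j => (1 - s) * z u j x + s * z v j x.
      by apply/funext => j; rewrite /z/fcomb; ring.
    by apply: gmean_concave => // j; exact: z0.
- by apply: measurable_funM => //; exact: mF.
- by apply: measurable_funM => //; exact: mF.
Qed.

(** Moving the j-th entry of a near-maximiser a fraction t n of the way towards
[v] raises the functional by at most the defect (t n)^2, which is small compared
with t n. *)
Let variation n u j v : S n u -> K j v -> exists c : I -> X -> R,
  [/\ (forall i x, c i x = if i == j
         then (1 - t n) * z u i x + t n * (v x + eps * w j x) else z u i x),
      measurable_fun [set: X]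
        (fun x => gmean theta (c^~ x) / c j x * (v x + eps * w j x)),
      (forall i x, 0 <= c i x) &
      (\int[mu]_x (gmean theta (c^~ x) / c j x * (v x + eps * w j x))%:E <=
       (M / (1 - t n) + t n / theta j)%:E)%E].
Proof.
move=> [Ku Mu] Kv; have /andP[t0 t1] := t01 n.
have t1' : 0 < 1 - t n by lra.
have tt01 : 0 <= t n <= 1 by lra.
pose u' i := if i == j then fun x => (1 - t n) * u i x + t n * v x else u i.
have Ku' : PK u'.
  move=> i; rewrite /u'; case: eqP => [->|_]; last exact: Ku.
  exact: K_convex.
have cE i x : z u' i x = if i == j
    then (1 - t n) * z u i x + t n * (v x + eps * w j x) else z u i x.
  by rewrite /z /u'; case: eqP => // ->; ring.
have [mv v0] := K_nneg Kv.
have mv' : measurable_fun [set: X] (fun x => v x + eps * w j x).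
  by apply: measurable_funD => //; exact: measurable_funM.
have v'0 x : 0 <= v x + eps * w j x by rewrite addr_ge0// mulr_ge0// ltW.
exists (z u').
have mq : measurable_fun [set: X]
    (fun x => F u' x / z u' j x * (v x + eps * w j x)).
  apply: measurable_funM => //; apply: measurable_funM; first exact: mF.
  by apply: measurable_inv_nneg => [|x]; [exact: mz|exact: z0].
split=> //; first by move=> i x; exact: z0.
have q0 x : 0 <= F u' x / z u' j x * (v x + eps * w j x).
  by rewrite mulr_ge0// divr_ge0// z0.
have th0 := theta_gt0 j.
have tht : 0 < theta j * t n by rewrite mulr_gt0.
have : (\int[mu]_x (F u x)%:E + (theta j * t n)%:E *
    \int[mu]_x (F u' x / z u' j x * (v x + eps * w j x))%:E <=
    (1 + theta j * t n / (1 - t n))%:E * \int[mu]_x (F u' x)%:E)%E.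
  have k0 : 0 <= 1 + theta j * t n / (1 - t n).
    by rewrite addr_ge0// divr_ge0// ltW.
  rewrite -!integralZ_nneg ?(ltW tht)//; try exact: mF.
  rewrite -integralD_nneg//; try exact: mF; try by move=> x; rewrite mulr_ge0// ltW.
    apply: le_integral_EFin.
    - apply: measurable_funD; first exact: mF.
      by apply: measurable_funM.
    - by apply: measurable_funM => //; exact: mF.
    - by move=> x; rewrite addr_ge0// mulr_ge0// ltW.
    - by move=> x; rewrite mulr_ge0.
    - apply: aeW => x; rewrite [leRHS]mulrC.
      apply: gmean_variation => //.
      + exact: theta_le1.
      + by move=> i; exact: z0.
      + by rewrite cE eqxx.
      + by move=> i /negbTE ij; rewrite cE ij.
  exact: measurable_funM.
rewrite (Phi_fin Ku) (Phi_fin Ku') -EFinM.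
have : (0 <= \int[mu]_x (F u' x / z u' j x * (v x + eps * w j x))%:E)%E.
  by apply: integral_ge0 => x _; rewrite lee_fin.
rewrite -/(F u' _).
case: (integral _ _ _) => [r||]//; last first.
  by move=> _; rewrite mulry gtr0_sg// mul1e addey.
move=> _; rewrite -EFinM -EFinD !lee_fin => H.
have PM := PhiM Ku'.
have {H} : theta j * t n * r <= theta j * t n * (M / (1 - t n) + t n / theta j).
  have -> : theta j * t n * (M / (1 - t n) + t n / theta j) =
      (1 + theta j * t n / (1 - t n)) * M - (M - t n ^+ 2).
    by field; rewrite !gt_eqF.
  have k0 : 0 <= 1 + theta j * t n / (1 - t n).
    by rewrite addr_ge0// divr_ge0// ltW.
  have := ler_wpM2l k0 PM; move: (M) (Phi u) (Phi u') Mu H => M' a b.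
  move: (_ / _) => k ? ? ?; lra.
by rewrite ler_pM2l.
Qed.

(** The weights are phi_j = \prod_i z_i^theta_i / z_j on the set where all w_i are
positive, where z = u + eps w and u is the limit of near-maximisers; the term
eps w keeps z_j away from 0. *)
Lemma perturbed_maximiser : exists phi : I -> X -> R,
  [/\ forall j, measurable_fun [set: X] (phi j), forall j x, 0 <= phi j x,
      {ae mu, forall x, positivity_set w x -> 1 <= gmean theta (phi^~ x)} &
      forall j v, K j v ->
        (\int[mu]_x (v x * phi j x)%:E <= ((1 + eps) * B)%:E)%E].
Proof.
have [n f Sf j|m n mn u [Ku Mu]|n|n s u v s01 [Ku Mu] [Kv Mv]|u_ Su ucv] :=
  @forward_convex_compactness _ _ _ mu I S mu_sf.
- exact: K_nneg (Sf.1 j).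
- split => //; apply: le_trans Mu; rewrite lerD2l lerN2.
  have tn n' : 0 <= t n' by have /andP[/ltW] := t01 n'.
  rewrite ler_pXn2r ?nnegrE // /t ler_pM2r //= lef_pV2 ?posrE ?ltr0n //.
  by rewrite ler_nat.
- have /andP[t0 _] := t01 n.
  have [_ [u Ku <-] uM] := sup_adherent (exprn_gt0 2 t0) hsM.
  by exists u; split => //; exact: ltW.
- split; first by move=> j; exact: K_convex.
  apply: le_trans (Phi_concave s01 Ku Kv).
  have /andP[s0 s1] := s01.
  move: (Phi u) (Phi v) (M - t n ^+ 2) Mu Mv => a b m am bm.
  by have := ler_wpM2l s0 bm; have : (1 - s) * m <= (1 - s) * a;
    [rewrite ler_wpM2l// subr_ge0|lra].
have Ku n : PK (u_ n) := (Su n).1.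
have u0 n j x : 0 <= u_ n j x by exact: (K_nneg (Ku n j)).2.
have mu_ n j : measurable_fun [set: X] (u_ n j) by exact: (K_nneg (Ku n j)).1.
pose us j := limfun (fun n => u_ n j).
have mus j : measurable_fun [set: X] (us j) by exact: measurable_limfun.
have us0 j x : 0 <= us j x by exact: limfun_ge0.
pose Om := positivity_set w.
have mOm : measurable Om by exact: measurable_positivity_set.
have good : {ae mu, forall x, Om x -> forall j,
    u_ n j x @[n --> \oo] --> us j x}.
  have nb := ae_not_pinfty (fun n => mF (Ku n)) (fun n x => F0 (u_ n) x)
    (fun n => iF (Ku n)).
  apply: filterS2 ucv nb => x dich nby Omx j.
  have [[l ul]|uy] := dich j; first by rewrite /us (limfunE ul).
  exfalso; apply: nby; apply: (@gmean_dvg _ (fun i => eps * w i x) j).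
  - by move=> i; rewrite mulr_gt0.
  - by move=> n i; rewrite /z lerDr.
  - apply/cvgryPge => A; have /cvgryPge/(_ A) := uy; apply: filterS => n An.
    by rewrite /z (le_trans An)// lerDl mulr_ge0// ltW.
pose zs j x := us j x + eps * w j x.
have mzs j : measurable_fun [set: X] (zs j).
  by apply: measurable_funD => //; exact: measurable_funM.
have zs0 j x : 0 <= zs j x by rewrite addr_ge0// mulr_ge0// ltW.
have zs_gt0 j x : Om x -> 0 < zs j x by move=> Ox; rewrite ltr_wpDl// mulr_gt0.
pose phi j x := \1_Om x * (gmean theta (zs^~ x) / zs j x).
have mphi j : measurable_fun [set: X] (phi j).
  apply: measurable_funM; first exact: measurable_indic.
  apply: measurable_funM; first exact: measurable_gmean.
  exact: measurable_inv_nneg.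
have phi0 j x : 0 <= phi j x.
  by rewrite mulr_ge0// ?indicE// divr_ge0// gmean_ge0.
exists phi; split => //.
  apply: aeW => x Ox; rewrite le_eqVlt; apply/orP; left; apply/eqP.
  rewrite -[LHS](@gmean_quotient (zs^~ x)) => [|j]; last exact: zs_gt0.
  by congr gmean; apply/funext => j; rewrite /phi indicE mem_set// mul1r.
move=> j v Kv; have [mv v0] := K_nneg Kv.
pose v' x := v x + eps * w j x.
have mv' : measurable_fun [set: X] v'.
  by apply: measurable_funD => //; exact: measurable_funM.
have v'0 x : 0 <= v' x by rewrite addr_ge0// mulr_ge0// ltW.
have /choice[c cP] : forall n, exists c : I -> X -> R,
  [/\ (forall i x, c i x = if i == j
         then (1 - t n) * z (u_ n) i x + t n * v' x else z (u_ n) i x),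
      measurable_fun [set: X] (fun x => gmean theta (c^~ x) / c j x * v' x),
      (forall i x, 0 <= c i x) &
      (\int[mu]_x (gmean theta (c^~ x) / c j x * v' x)%:E <=
       (M / (1 - t n) + t n / theta j)%:E)%E].
  by move=> n; exact: variation (Su n) Kv.
have t_cvg : t @ \oo --> 0.
  by rewrite -[0](mul0r 2^-1); apply: cvgM; [exact: cvg_harmonic|exact: cvg_cst].
have mid : (\int[mu]_x (phi j x * v' x)%:E <= M%:E)%E.
  apply: (@fatou_cvg _ _ _ mu
    (fun n x => \1_Om x * (gmean theta ((c n)^~ x) / c n j x * v' x)) _
    (fun n => M / (1 - t n) + t n / theta j)).
  - move=> n; apply: measurable_funM; first exact: measurable_indic.
    by have [] := cP n.
  - move=> n x; have [_ _ c0 _] := cP n.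
    by rewrite mulr_ge0 ?indicE// mulr_ge0// divr_ge0// gmean_ge0.
  - exact: measurable_funM.
  - by move=> x; rewrite mulr_ge0.
  - apply: filterS good => x gx.
    have [Ox|nOx] := pselect (Om x); last first.
      rewrite /phi indicE memNset//= mul0r.
      rewrite [X in X @ _ --> _](_ : _ = cst (0 * v' x)); first exact: cvg_cst.
      by apply/funext => n; rewrite !mul0r.
    rewrite /phi -[in X in _ --> X]mulrA; apply: cvgM; first exact: cvg_cst.
    have zcv i : z (u_ n) i x @[n --> \oo] --> zs i x.
      by apply: cvgD; [exact: gx|exact: cvg_cst].
    have ccv i : c n i x @[n --> \oo] --> zs i x.
      have [ij|ij] := eqVneq i j; last first.
        rewrite [X in X @ _ --> _](_ : _ = fun n => z (u_ n) i x)//.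
        by apply/funext => n; have [-> _ _ _] := cP n; rewrite (negbTE ij).
      rewrite [X in X @ _ --> _](_ : _ =
          fun n => (1 - t n) * z (u_ n) i x + t n * v' x); last first.
        by apply/funext => n; have [-> _ _ _] := cP n; rewrite ij eqxx.
      rewrite (_ : zs i x = (1 - 0) * zs i x + 0 * v' x); last by ring.
      apply: cvgD; apply: cvgM => //; last exact: cvg_cst.
      by apply: cvgB => //; exact: cvg_cst.
    apply: cvgM; last exact: cvg_cst.
    apply: cvgM; last by apply: cvgV => //; rewrite gt_eqF// zs_gt0.
    apply: cvg_gmean => // n i; by have [_ _ + _] := cP n.
  - move=> n; have [_ mc c0 ci] := cP n; apply: le_trans ci.
    apply: le_integral_EFin => //.
    + by apply: measurable_funM => //; exact: measurable_indic.
    + by move=> x; rewrite mulr_ge0 ?indicE// mulr_ge0// divr_ge0// gmean_ge0.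
    + by move=> x; rewrite mulr_ge0// divr_ge0// gmean_ge0.
    + apply: aeW => x; apply: ler_piMl.
        by rewrite mulr_ge0// divr_ge0// gmean_ge0.
      by rewrite indicE; case: (_ \in _).
  - rewrite [X in _ --> X](_ : M = M / (1 - 0) + 0 / theta j); last by field; rewrite gt_eqF.
    apply: cvgD; last exact: (cvgM t_cvg (cvg_cst _)).
    apply: (cvgM (cvg_cst _)); apply: cvgV; first by rewrite subr0.
    exact: (cvgB (cvg_cst _) t_cvg).
(* v <= v + eps w *)
apply: (@le_trans _ _ M%:E); last by rewrite lee_fin MB.
apply: le_trans mid; apply: le_integral_EFin.
- exact: measurable_funM.
- exact: measurable_funM.
- by move=> x; rewrite mulr_ge0.
- by move=> x; rewrite mulr_ge0.
- apply: aeW => x; rewrite mulrC ler_wpM2l// lerDl mulr_ge0// ltW//.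
Qed.

End perturbed_maximiser.

(** The family S n consists of the weights that are good up to the factor
1 + 1/(n+1), where the normalisation is required only on the set where all
functions w n j are positive; [perturbed_maximiser] shows that it is not empty.
The families are convex, again because the geometric mean is concave, and the
limit of a convergent selection inherits the integral bounds by Fatou's lemma and
the normalisation by continuity.  It is finite where all w n j are positive for
some n, because the integrals of w n j against the weights are bounded. *)
Theorem disentanglement (w : nat -> I -> X -> R) :
  (forall n j, K j (w n j)) ->
  (forall n, positivity_set (w n) `<=` positivity_set (w n.+1)) ->
  exists phi : I -> X -> R,
  [/\ forall j, measurable_fun [set: X] (phi j), forall j x, 0 <= phi j x,
      {ae mu, forall x, (exists n, positivity_set (w n) x) ->
        1 <= gmean theta (phi^~ x)} &
      forall j v, K j v -> (\int[mu]_x (v x * phi j x)%:E <= B%:E)%E].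
Proof.
move=> Kw wS.
have B0 : 0 <= B.
  rewrite -lee_fin; apply: le_trans (K_bound (Kw 0%N)).
  by apply: integral_ge0 => x _; rewrite lee_fin gmean_ge0.
have wS' m n : (m <= n)%N -> positivity_set (w m) `<=` positivity_set (w n).
  move=> /subnK <-; elim: (n - m)%N => [|k ih]; first by rewrite add0n.
  by rewrite addSn; apply: subset_trans ih _; exact: wS.
pose S n : set (I -> X -> R) := [set phi : I -> X -> R | [/\
  forall j, measurable_fun [set: X] (phi j) /\ forall x, 0 <= phi j x,
  {ae mu, forall x, positivity_set (w n) x -> 1 <= gmean theta (phi^~ x)} &
  forall j v, K j v ->
    (\int[mu]_x (v x * phi j x)%:E <= ((1 + harmonic n) * B)%:E)%E]].
have hn n : 0 < harmonic n :> R by rewrite /= invr_gt0 ltr0n.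
have [n f [+ _ _] j|m n mn f [f0 fw fK]|n|n s f g s01 [f0 fw fK] [g0 gw gK]|f_ Sf fcv] :=
  @forward_convex_compactness _ _ _ mu I S mu_sf.
- exact.
- split => //.
    by apply: filterS fw => x fx /(wS' _ _ mn)/fx.
  move=> j v Kv; apply: le_trans (fK j v Kv) _.
  rewrite lee_fin ler_wpM2r// lerD2l/= lef_pV2 ?posrE ?ltr0n//.
  by rewrite ler_nat.
- have [phi [mphi phi0 phiw phiK]] := perturbed_maximiser (Kw n) (hn n).
  by exists phi; split.
- have /andP[s0 s1] := s01; have s'0 : 0 <= 1 - s by lra.
  split.
  + move=> j; split => [|x].
      apply: measurable_funD; apply: measurable_funM => //;
        [exact: (f0 j).1|exact: (g0 j).1].
    by rewrite addr_ge0// mulr_ge0//; [exact: (f0 j).2|exact: (g0 j).2].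
  + apply: filterS2 fw gw => x fx gx wx.
    apply: (@le_trans _ _ ((1 - s) * gmean theta (f^~ x) + s * gmean theta (g^~ x))).
      have := ler_wpM2l s'0 (fx wx); have := ler_wpM2l s0 (gx wx); lra.
    by apply: gmean_concave => // j; [exact: (f0 j).2|exact: (g0 j).2].
  + move=> j v Kv; have [mv v0] := K_nneg Kv.
    have mvf : measurable_fun [set: X] (fun x => v x * f j x).
      by apply: measurable_funM => //; exact: (f0 j).1.
    have mvg : measurable_fun [set: X] (fun x => v x * g j x).
      by apply: measurable_funM => //; exact: (g0 j).1.
    have vf0 x : 0 <= v x * f j x by rewrite mulr_ge0// (f0 j).2.
    have vg0 x : 0 <= v x * g j x by rewrite mulr_ge0// (g0 j).2.
    have -> : (\int[mu]_x (v x * fcomb s f g j x)%:E =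
        (1 - s)%:E * \int[mu]_x (v x * f j x)%:E
        + s%:E * \int[mu]_x (v x * g j x)%:E)%E.
      rewrite -!integralZ_nneg// -integralD_nneg//.
      - by apply: eq_integral => x _; congr EFin; rewrite /fcomb; ring.
      - exact: measurable_funM.
      - exact: measurable_funM.
      - by move=> x; rewrite mulr_ge0.
      - by move=> x; rewrite mulr_ge0.
    have fj := fK j v Kv; have gj := gK j v Kv.
    apply: le_trans (leeD (lee_wpmul2l _ fj) (lee_wpmul2l _ gj)) _;
      rewrite ?lee_fin//.
    by rewrite -mulrDl subrK mul1r.
have mf n j : measurable_fun [set: X] (f_ n j) by have [f0 _ _] := Sf n; exact: (f0 j).1.
have f0 n j x : 0 <= f_ n j x by have [f0 _ _] := Sf n; exact: (f0 j).2.
pose Om := \bigcup_n positivity_set (w n).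
have mOm : measurable Om.
  apply: bigcup_measurable => n _; apply: measurable_positivity_set => j.
  exact: (K_nneg (Kw n j)).1.
have good : {ae mu, forall x, Om x -> forall j,
    f_ n j x @[n --> \oo] --> limfun (fun n => f_ n j) x}.
  have nb : {ae mu, forall x, forall mj : nat * I,
      ~ (w mj.1 mj.2 x * f_ n mj.2 x @[n --> \oo] --> +oo)}.
    apply: ae_forall_countable => -[m j] /=.
    have [mw w0] := K_nneg (Kw m j).
    apply: (@ae_not_pinfty _ _ _ _ _ (2 * B)) => [n|n x|n].
    - exact: measurable_funM.
    - by rewrite mulr_ge0.
    - have [_ _ fK] := Sf n; apply: le_trans (fK _ _ (Kw m j)) _.
      rewrite lee_fin ler_wpM2r//.
      have : harmonic n <= 1 :> R by rewrite /= invf_le1 ?ler1n// ltr0n.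
      by move: (harmonic n) => y; lra.
  apply: filterS2 fcv nb => x dich nby [m _ wx] j.
  have [[l fl]|fy] := dich j; first by rewrite (limfunE fl).
  exfalso; apply: (nby (m, j)) => /=.
  apply/cvgryPge => A; have /cvgryPge/(_ (A / w m j x)) := fy.
  by apply: filterS => n; rewrite ler_pdivrMr// mulrC.
pose phi j x := \1_Om x * limfun (fun n => f_ n j) x.
have ml j : measurable_fun [set: X] (limfun (fun n => f_ n j)).
  exact: measurable_limfun.
have l0 j x : 0 <= limfun (fun n => f_ n j) x by exact: limfun_ge0.
have mphi j : measurable_fun [set: X] (phi j).
  by apply: measurable_funM => //; exact: measurable_indic.
have phi0 j x : 0 <= phi j x by rewrite mulr_ge0// indicE.
exists phi; split => //.
- have fw : {ae mu, forall x, forall n, positivity_set (w n) x ->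
      1 <= gmean theta ((f_ n)^~ x)}.
    by apply: ae_foralln => n; have [] := Sf n.
  apply: filterS2 good fw => x gx fx [m wx].
  have Ox : Om x by exists m.
  have gcv : gmean theta ((f_ n)^~ x) @[n --> \oo] --> gmean theta (phi^~ x).
    apply: cvg_gmean => // j; rewrite /phi indicE mem_set// mul1r.
    exact: gx.
  rewrite -(cvg_lim _ gcv)//; apply: limr_ge.
    by apply/cvg_ex; exists (gmean theta (phi^~ x)).
  by exists m => // n /= mn; apply: fx; exact: wS' mn _ wx.
- move=> j v Kv; have [mv v0] := K_nneg Kv.
  apply: (@fatou_cvg _ _ _ mu (fun n x => \1_Om x * (v x * f_ n j x)) _
    (fun n => (1 + harmonic n) * B)).
  + move=> n; apply: measurable_funM; first exact: measurable_indic.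
    exact: measurable_funM.
  + by move=> n x; rewrite mulr_ge0 ?indicE// mulr_ge0.
  + exact: measurable_funM.
  + by move=> x; rewrite mulr_ge0.
  + apply: filterS good => x gx; rewrite /phi.
    have [Ox|nOx] := pselect (Om x); last first.
      rewrite indicE memNset//= mul0r mulr0.
      rewrite [X in X @ _ --> _](_ : _ = cst 0); first exact: cvg_cst.
      by apply/funext => n; rewrite mul0r.
    rewrite indicE mem_set//= mul1r.
    under eq_fun do rewrite mul1r.
    exact: (cvgM (cvg_cst _) (gx Ox j)).
  + move=> n; have [_ _ fK] := Sf n; apply: le_trans (fK j v Kv).
    apply: le_integral_EFin => //.
    * apply: measurable_funM; first exact: measurable_indic.
      exact: measurable_funM.
    * exact: measurable_funM.
    * by move=> x; rewrite mulr_ge0 ?indicE// mulr_ge0.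
    * by move=> x; rewrite mulr_ge0.
    * apply: aeW => x; apply: ler_piMl; first by rewrite mulr_ge0.
      by rewrite indicE; case: (_ \in _).
  + rewrite [X in _ --> X](_ : B = (1 + 0) * B); last by ring.
    by apply: (cvgM _ (cvg_cst _)); exact: (cvgD (cvg_cst _) cvg_harmonic).
Qed.

End disentanglement.

(** * Exhausting the space *)

Section exhaustion.
Context {R : realType} {d : measure_display} {X : measurableType d}.
Variable mu : {measure set X -> \bar R}.

Lemma ae_notin_measure0 (E : set X) : measurable E ->
  {ae mu, forall x, ~ E x} -> mu E = 0%E.
Proof.
move=> mE nE; apply/negligibleP => //.
by apply: negligibleS nE => x Ex /=; apply; exact: Ex.
Qed.

(** Averages of a sequence in K that maximises the rho-measure of the set of
positivity.  If the union of these sets missed a set of positive measure,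
averaging with a function given by the saturation hypothesis would beat the
supremum. *)
Lemma exhausting_sequence (K : set (X -> R)) :
  sigma_finite [set: X] mu -> K !=set0 ->
  (forall u, K u -> measurable_fun [set: X] u /\ forall x, 0 <= u x) ->
  (forall t u v, 0 <= t <= 1 -> K u -> K v ->
    K (fun x => (1 - t) * u x + t * v x)) ->
  (forall E, measurable E -> (0 < mu E)%E -> exists E' u,
    [/\ measurable E', E' `<=` E, (0 < mu E')%E, K u &
        {ae mu, forall x, E' x -> 0 < u x}]) ->
  exists w : nat -> X -> R, [/\ forall n, K (w n),
    forall n x, 0 < w n x -> 0 < w n.+1 x &
    {ae mu, forall x, exists n, 0 < w n x}].
Proof.
move=> sf [u0 Ku0] Kn Kc Ksat.
have [rho [mrho rho01 irho]] := sigma_finite_density sf.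
have rho0 x : 0 < rho x by have /andP[] := rho01 x.
pose pos (u : X -> R) := [set x | 0 < u x].
have mpos u : K u -> measurable (pos u).
  move=> /Kn[mu_ _].
  have := measurable_fun_ltr (@measurable_cst _ _ X _ setT (0 : R)) mu_.
  by move=> /(_ measurableT [set true]); rewrite setTI; apply.
pose m E := (\int[mu]_x (rho x * \1_E x)%:E)%E.
have mi E : measurable E -> measurable_fun [set: X] (fun x => rho x * \1_E x).
  by move=> mE; apply: measurable_funM => //; exact: measurable_indic.
have i0 E x : 0 <= rho x * \1_E x by rewrite mulr_ge0 ?indicE// ltW.
have m_le E F : measurable E -> measurable F -> E `<=` F -> (m E <= m F)%E.
  move=> mE mF EF; apply: le_integral_EFin => //; [exact: mi|exact: mi|].
  apply: aeW => x; rewrite ler_wpM2l ?(ltW (rho0 x))// !indicE ler_nat.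
  by have [/set_mem/EF/mem_set ->//|] := boolP (x \in E).
have m0 E : (0 <= m E)%E by apply: integral_ge0 => x _; rewrite lee_fin.
have mT E : measurable E -> (m E <= \int[mu]_x (rho x)%:E)%E.
  move=> mE; apply: le_integral_EFin => //; first exact: mi.
  - by move=> x; exact: ltW.
  - apply: aeW => x; apply: ler_piMr; first exact: ltW.
    by rewrite indicE; case: (_ \in _).
have m_fin E : measurable E -> m E \is a fin_num.
  move=> mE; rewrite ge0_fin_numE//; exact: le_lt_trans (mT _ mE) irho.
pose g u := fine (m (pos u)).
have gE u : K u -> (g u)%:E = m (pos u).
  by move=> Ku; rewrite fineK// m_fin//; exact: mpos.
have hs : has_sup (g @` K).
  split; first by exists (g u0), u0.
  exists (fine (\int[mu]_x (rho x)%:E)%E) => _ [u Ku <-].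
  apply: fine_le; [by apply: m_fin; exact: mpos| |by apply: mT; exact: mpos].
  by rewrite ge0_fin_numE// integral_ge0// => x _; rewrite lee_fin ltW.
pose s := sup (g @` K).
have /choice[v vP] : forall n, exists v, K v /\ s - harmonic n < g v.
  move=> n; have hn : 0 < harmonic n :> R by rewrite /= invr_gt0 ltr0n.
  by have [_ [v Kv <-] gv] := sup_adherent hn hs; exists v.
have h01 : 0 <= (2^-1 : R) <= 1 by lra.
pose avg (a b : X -> R) x := (1 - 2^-1) * a x + 2^-1 * b x.
have Kavg a b : K a -> K b -> K (avg a b) by exact: Kc.
have avgl a b x : K a -> K b -> 0 < a x -> 0 < avg a b x.
  by move=> _ /Kn[_ /(_ x) b0] a0; rewrite /avg; lra.
have avgr a b x : K a -> K b -> 0 < b x -> 0 < avg a b x.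
  by move=> /Kn[_ /(_ x) a0] _ b0; rewrite /avg; lra.
pose w := fix w n := if n is k.+1 then avg (w k) (v k.+1) else v 0%N.
have Kw n : K (w n).
  by elim: n => [|n ih] /=; [exact: (vP 0%N).1|apply: Kavg ih (vP n.+1).1].
exists w; split => //.
  by move=> n x wx /=; apply: avgl => //; exact: (vP n.+1).1.
have gw n : s - harmonic n < g (w n).
  apply: lt_le_trans (vP n).2 _; rewrite -lee_fin !gE//; last exact: (vP n).1.
  apply: m_le; [exact: mpos (vP n).1|exact: mpos|].
  case: n => [//|n] x /= vx; apply: avgr => //; exact: (vP n.+1).1.
pose U := \bigcup_n pos (w n).
have mU : measurable U by apply: bigcup_measurable => n _; exact: mpos.
suff : mu (~` U) = 0%E.
  move=> U0; exists (~` U); split => //; first exact: measurableC.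
  by move=> x /= nex [n _ wx]; apply: nex; exists n.
apply/eqP; rewrite eq_le measure_ge0 andbT leNgt; apply/negP => muU.
have [E' [u [mE' E'U muE' Ku uE']]] := Ksat _ (measurableC mU) muU.
have mE : measurable (E' `&` pos u) by apply: measurableI => //; exact: mpos.
pose eta := fine (m (E' `&` pos u)).
have eta0 : 0 < eta.
  rewrite -lte_fin fineK ?m_fin// lt0e m0 andbT; apply/eqP => mE0.
  have : {ae mu, forall x, ~ E' x}.
    have mEi : measurable_fun [set: X]
        (fun x => (rho x * \1_(E' `&` pos u) x)%:E).
      by apply/measurable_EFinP; exact: mi.
    have abs0 : (\int[mu]_x `|(rho x * \1_(E' `&` pos u) x)%:E| = 0)%E.
      rewrite -mE0; apply: eq_integral => x _.
      by rewrite gee0_abs// lee_fin.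
    have /(ae_eq_integral_abs mu measurableT mEi) ae0 := abs0.
    apply: filterS2 ae0 uE' => x /(_ Logic.I)/= + ux E'x.
    rewrite indicE mem_set; last by split => //; exact: ux.
    by rewrite mulr1 => -[] /eqP; rewrite gt_eqF.
  by move=> /(ae_notin_measure0 mE') E'0; rewrite E'0 ltxx in muE'.
have contra n : g (w n) + eta <= s.
  apply: (@le_trans _ _ (g (avg (w n) u))); last first.
    by apply: sup_upper_bound => //; exists (avg (w n) u) => //; exact: Kavg.
  have Ka : K (avg (w n) u) by exact: Kavg.
  suff : ((g (w n))%:E + eta%:E <= (g (avg (w n) u))%:E)%E by [].
  rewrite (gE _ (Kw n)) (gE _ Ka) /eta fineK ?m_fin//.
  rewrite /m -integralD_nneg//; try exact: mi; last by apply: mi; exact: mpos.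
  apply: le_integral_EFin => //.
  - by apply: measurable_funD; apply: mi => //; exact: mpos.
  - by apply: mi; exact: mpos.
  - by move=> x; rewrite addr_ge0.
  - apply: aeW => x; rewrite -mulrDr ler_wpM2l ?(ltW (rho0 x))//.
    have [px|npx] := pselect (pos (w n) x).
      rewrite [\1_(E' `&` _) x]indicE memNset => [|[/E'U + _]]; last first.
        by apply; exists n.
      rewrite addr0 !indicE !mem_set//.
      exact: avgl.
    rewrite [\1_(pos (w n)) x]indicE memNset// add0r.
    have [[_ ux]|nE] := pselect ((E' `&` pos u) x).
      by rewrite !indicE (@mem_set _ (pos (avg _ _)))//= ?ler_nat ?leq_b1//; exact: avgr.
    by rewrite [\1_(E' `&` _) x]indicE memNset// indicE.
have : \forall n \near \oo, harmonic n < eta.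
  by apply: cvgr_lt eta0; exact: cvg_harmonic.
move=> [n _ /(_ n (leqnn n))] hn.
by have := contra n; have := gw n; move: hn; move: (harmonic n) (g (w n)) => a b; lra.
Qed.

End exhaustion.

(** * The l^p norm as a supremum of countably many functionals *)

Section lp_duality.
Context {R : realType}.

Definition lpnorm (p : R) n (x : 'I_n -> R) : R := (\sum_k `|x k| `^ p) `^ p^-1.

Lemma lpnorm_ge0 p n (x : 'I_n -> R) : 0 <= lpnorm p x.
Proof. exact: powR_ge0. Qed.

(** Young's inequality in the form that includes p = 1, where the conjugate
exponent is infinite: Bernoulli's inequality for (x / a)^p. *)
Lemma young_tangent (p a x : R) : 1 <= p -> 0 < a -> 0 <= x ->
  a `^ (p - 1) * x <= (1 - p^-1) * a `^ p + p^-1 * x `^ p.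
Proof.
move=> p1 a0 x0; have p0 : 0 < p by rewrite (lt_le_trans _ p1).
have xa0 : 0 <= x / a by rewrite divr_ge0// ltW.
have xpE : x `^ p = a `^ p * (x / a) `^ p.
  by rewrite -powRM ?(ltW a0)// mulrC divfK// gt_eqF.
have aE : a `^ (p - 1) * x = a `^ p * (x / a).
  rewrite powRB ?(gt_eqF a0) ?implybT// powRr1 ?ltW//.
  by rewrite mulrAC mulrA.
rewrite aE xpE.
have -> : (1 - p^-1) * a `^ p + p^-1 * (a `^ p * (x / a) `^ p) =
  a `^ p * (1 + p^-1 * ((x / a) `^ p - 1)) by ring.
rewrite ler_pM2l ?powR_gt0//.
have yE : x / a = ((x / a) `^ p) `^ p^-1.
  by rewrite -powRrM divff ?gt_eqF// powRr1.
move: p1; rewrite le_eqVlt => /predU1P[<-|p1].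
  by rewrite invr1 powRr1//; lra.
rewrite {1}yE; apply: powR_le_affine; first exact: powR_ge0.
by rewrite invr_gt0 p0/= invf_lt1.
Qed.

(** The coefficients of the functional of norm 1 that attains the norm at a. *)
Definition lpdual (p : R) n (a : 'I_n -> R) k : R :=
  (a k / lpnorm p a) `^ (p - 1).

Section dual.
Variables (p : R) (n : nat) (a : 'I_n -> R).
Hypothesis p1 : 1 <= p.
Hypothesis a0 : forall k, 0 < a k.

Let p0 : 0 < p. Proof. by rewrite (lt_le_trans _ p1). Qed.

Let normalise (x : 'I_n -> R) : 0 < lpnorm p x ->
  \sum_k (`|x k| / lpnorm p x) `^ p = 1.
Proof.
move=> H0; under eq_bigr do rewrite powRM ?invr_ge0 ?(ltW H0)//.
rewrite -mulr_suml -powR_inv1 ?(ltW H0)// -powRrM /lpnorm -powRrM.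
have S0 : 0 <= \sum_k `|x k| `^ p by apply: sumr_ge0 => k _; exact: powR_ge0.
rewrite mulN1r mulrN mulVf ?gt_eqF// powRN powRr1//.
rewrite divff//; apply: contraTneq H0 => E; rewrite /lpnorm E powR0 ?ltxx//.
by rewrite invr_eq0 gt_eqF.
Qed.

Lemma lpnorm_gt0 (k : 'I_n) : 0 < lpnorm p a.
Proof.
apply: powR_gt0; rewrite (bigD1 k)//= ltr_pwDl//.
  by apply: powR_gt0; rewrite normr_gt0 gt_eqF.
by apply: sumr_ge0 => i _; exact: powR_ge0.
Qed.

Lemma lpdual_le (x : 'I_n -> R) : \sum_k lpdual p a k * x k <= lpnorm p x.
Proof.
have [H0|H0] := ltP 0 (lpnorm p x); last first.
  have /eqP : lpnorm p x = 0 by apply/eqP; rewrite eq_le H0 lpnorm_ge0.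
  rewrite /lpnorm powR_eq0 => /andP[]; rewrite psumr_eq0; last first.
    by move=> k _; exact: powR_ge0.
  move=> /allP xk _; rewrite big1 ?lpnorm_ge0// => k _.
  have := xk k (mem_index_enum k); rewrite powR_eq0 normr_eq0 => /andP[/eqP -> _].
  by rewrite mulr0.
have Sx := normalise H0.
have pV1 : p^-1 <= 1 by rewrite invf_le1.
have Sa : \sum_k (a k / lpnorm p a) `^ p <= 1.
  have [k _|n0] := pickP (fun _ : 'I_n => true); last by rewrite big_pred0.
  rewrite -(normalise (lpnorm_gt0 k)); apply: ler_sum => i _.
  by rewrite (gtr0_norm (a0 i)).
rewrite -[leRHS]mul1r -ler_pdivrMr// mulr_suml.
apply: (@le_trans _ _ (\sum_k ((1 - p^-1) * (a k / lpnorm p a) `^ p +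
    p^-1 * (`|x k| / lpnorm p x) `^ p))).
  apply: ler_sum => k _; have A0 := lpnorm_gt0 k.
  apply: (@le_trans _ _ (lpdual p a k * (`|x k| / lpnorm p x))).
    rewrite -mulrA ler_wpM2l ?powR_ge0// ler_wpM2r ?invr_ge0 ?lpnorm_ge0//.
    exact: ler_norm.
  apply: young_tangent => //; first by rewrite divr_gt0.
  exact: divr_ge0 (normr_ge0 _) (ltW H0).
have -> : \sum_k ((1 - p^-1) * (a k / lpnorm p a) `^ p +
    p^-1 * (`|x k| / lpnorm p x) `^ p) =
  (1 - p^-1) * (\sum_k (a k / lpnorm p a) `^ p) + p^-1.
  by rewrite -[X in _ = _ + X]mulr1 -[X in _ = _ + _ * X]Sx !mulr_sumr big_split.
by rewrite -lerBrDr -[leRHS]mulr1 ler_wpM2l// subr_ge0.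
Qed.

Lemma lpdual_norming : \sum_k lpdual p a k * a k = lpnorm p a.
Proof.
have [k _|n0] := pickP (fun _ : 'I_n => true); last first.
  by rewrite /lpnorm !big_pred0// powR0// invr_eq0 gt_eqF.
have A0 := lpnorm_gt0 k; have Sa := normalise A0.
rewrite -[RHS]mul1r -Sa mulr_suml; apply: eq_bigr => i _.
rewrite (gtr0_norm (a0 i)) /lpdual; move: (lpnorm p a) A0 => A A0.
have q0 : 0 < a i / A by rewrite divr_gt0.
rewrite -(mulr_powRB1 (ltW q0) p0) mulrAC [RHS]mulrC.
by rewrite divfK ?gt_eqF.
Qed.

Lemma lpdual_le1 k : lpdual p a k <= 1.
Proof.
have A0 := lpnorm_gt0 k.
have q0 : 0 < a k / lpnorm p a by rewrite divr_gt0.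
have q1 : a k / lpnorm p a <= 1.
  rewrite ler_pdivrMr// mul1r /lpnorm.
  rewrite -[leLHS](powRr1 (ltW (a0 k))) -(divff (lt0r_neq0 p0)) powRrM.
  apply: ge0_ler_powR; rewrite ?nnegrE ?invr_ge0 ?(ltW p0) ?powR_ge0//.
    by apply: sumr_ge0 => i _; exact: powR_ge0.
  rewrite (bigD1 k)//= gtr0_norm// lerDl sumr_ge0// => i _; exact: powR_ge0.
rewrite /lpdual -[leRHS](powRr0 (a k / lpnorm p a)); apply: ger_powR; first by rewrite q0.
by rewrite subr_ge0.
Qed.

Lemma lpdual_ge0 k : 0 <= lpdual p a k.
Proof. exact: powR_ge0. Qed.

End dual.

(** The grid of mesh 1/(m+1) is shifted to have positive coordinates. *)
Definition grid n (mi : nat * {ffun 'I_n -> nat}) (k : 'I_n) : R :=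
  (mi.2 k).+1%:R / mi.1.+1%:R.

(** Compare y with the grid point a just above it in each coordinate: the
functional dual to a takes the value lpnorm p a >= lpnorm p y at a, and it
changes by at most n/(m+1) between a and y because its coefficients lie in
[0, 1]. *)
Lemma lpnorm_le_grid (p : R) n (y : 'I_n -> R) (s : R) : 1 <= p ->
  (forall k, 0 <= y k) ->
  (forall mi, \sum_k lpdual p (grid mi) k * y k <= s) -> lpnorm p y <= s.
Proof.
move=> p1 y0 H; have p0 : 0 < p by rewrite (lt_le_trans _ p1).
have bound m : lpnorm p y <= s + n%:R * harmonic m.
  pose i : {ffun 'I_n -> nat} := [ffun k => Num.truncn (y k * m.+1%:R)].
  have m0 : 0 < m.+1%:R :> R by rewrite ltr0n.
  have ya k : y k <= grid (m, i) k <= y k + m.+1%:R^-1.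
    have ym : 0 <= y k * m.+1%:R by rewrite mulr_ge0// ltW.
    have /andP[l u] := truncn_itv ym.
    rewrite /grid/= ffunE ler_pdivlMr// (ltW u)/= ler_pdivrMr//.
    by rewrite mulrDl mulVf ?gt_eqF// -natr1 lerD2r.
  have a0 k : 0 < grid (m, i) k by rewrite divr_gt0// ltr0n.
  apply: (@le_trans _ _ (lpnorm p (grid (m, i)))).
    rewrite /lpnorm; apply: ge0_ler_powR; rewrite ?nnegrE ?invr_ge0 ?(ltW p0)//;
      try by apply: sumr_ge0 => k _; exact: powR_ge0.
    apply: ler_sum => k _; have /andP[yk _] := ya k.
    apply: ge0_ler_powR; rewrite ?nnegrE ?(ltW p0)//.
    by rewrite ger0_norm// gtr0_norm.
  rewrite -lpdual_norming//.
  apply: (@le_trans _ _ (\sum_k (lpdual p (grid (m, i)) k * y k + harmonic m))).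
    apply: ler_sum => k _; have /andP[_ ak] := ya k.
    apply: (@le_trans _ _ (lpdual p (grid (m, i)) k * (y k + m.+1%:R^-1))).
      by rewrite ler_wpM2l// lpdual_ge0.
    rewrite mulrDr lerD2l/= ler_piMl ?invr_ge0 ?(ltW m0)//.
    exact: lpdual_le1.
  rewrite big_split/= lerD//.
  by rewrite sumr_const card_ord mulr_natl.
have hc : s + n%:R * harmonic m @[m --> \oo] --> s + n%:R * 0.
  apply: cvgD; first exact: cvg_cst.
  by apply: cvgM; [exact: cvg_cst|exact: cvg_harmonic].
rewrite -[leRHS]addr0 -(mulr0 n%:R) -(cvg_lim _ hc)//; apply: limr_ge.
  by apply/cvg_ex; exists (s + n%:R * 0).
exact: nearW.
Qed.

End lp_duality.

(** * Krivine's calculus and positive operators *)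

Section lattice_calculus.
Context {R : realType} {Y : normedLatticeType R}.
Implicit Types f z : Y.

Definition labs f : Y := ljoin f (- f).

Lemma lle_joinl f g : lle f (ljoin f g).
Proof. exact: ((ljoin_lub f g (ljoin f g)).1 (lle_refl _)).1. Qed.

Lemma lle_joinr f g : lle g (ljoin f g).
Proof. exact: ((ljoin_lub f g (ljoin f g)).1 (lle_refl _)).2. Qed.

Lemma lle_subr f g : lle f g -> lle 0 (g - f).
Proof. by move=> /(lleD2r (- f) _ _); rewrite subrr. Qed.

Lemma labs_ge0 f : lle 0 (labs f).
Proof.
have h0 : lle 0 (labs f - f).
  by have := lleD2r (- f) _ _ (lle_joinl f (- f)); rewrite subrr.
have h1 : lle (labs f - f) (labs f + labs f).
  have := lleD2r (labs f) _ _ (lle_joinr f (- f)).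
  by rewrite [X in lle X _]addrC.
have h : lle 0 (2^-1 *: (labs f + labs f)).
  by apply: lle_scale; [rewrite invr_ge0|exact: lle_trans h0 h1].
have E : 2^-1 *: (labs f + labs f) = labs f.
  by rewrite -mulr2n -(scaler_nat 2 (labs f)) scalerA mulVf ?scale1r// pnatr_eq0.
by rewrite E in h.
Qed.

Lemma norm_labs f : `|labs f| = `|f|.
Proof.
have E : ljoin (labs f) (- labs f) = labs f.
  apply: lle_anti; last exact: lle_joinl.
  apply/ljoin_lub; split; first exact: lle_refl.
  apply: lle_trans (labs_ge0 f).
  by have := lle_subr (labs_ge0 f) => /(lleD2r (- labs f) _ _); rewrite subr0 subrr add0r.
by apply/eqP; rewrite eq_le; apply/andP; split; apply: ler_lnorm;
  rewrite E; exact: lle_refl.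
Qed.

Section morphism.
Variables (n : nat) (D : set (('I_n -> R) -> R)) (tau : (('I_n -> R) -> R) -> Y).
Hypothesis DS : vector_sublattice D.
Hypothesis tauM : lattice_morphism_on D tau.

Lemma lattice_morphism_mono g h : D g -> D h -> (forall x, g x <= h x) ->
  lle (tau g) (tau h).
Proof.
move=> Dg Dh gh.
have -> : tau h = ljoin (tau g) (tau h).
  rewrite -tauM.2//; congr tau; apply/funext => x.
  by apply/esym/max_idPr; exact: gh.
exact: lle_joinl.
Qed.

Lemma lattice_morphism0 g : D g -> D (fun=> 0) /\ tau (fun=> 0) = 0.
Proof.
move=> Dg; have E : (fun=> 0) = (fun x : 'I_n -> R => -1 * g x + g x).
  by apply/funext => x; rewrite mulN1r addNr.
split; first by rewrite E; exact: DS.1.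
by rewrite E tauM.1// scaleN1r addNr.
Qed.

Lemma lattice_morphism_sum (c : 'I_n -> R) :
  D (fun=> 0) -> tau (fun=> 0) = 0 -> (forall k, D (fun x => x k)) ->
  D (fun x => \sum_k c k * x k) /\
  tau (fun x => \sum_k c k * x k) = \sum_k c k *: tau (fun x => x k).
Proof.
move=> D0 t0 Dx; rewrite -(big_enum _ _ _ (fun k => c k *: tau (fun x => x k))).
under [X in D X]eq_fun do rewrite -big_enum.
under [X in tau X]eq_fun do rewrite -big_enum.
elim: (enum _) => [|k s [Ds ts]].
  rewrite big_nil; under [X in D X]eq_fun do rewrite big_nil.
  by under [X in tau X]eq_fun do rewrite big_nil.
rewrite big_cons; under [X in D X]eq_fun do rewrite big_cons.
under [X in tau X]eq_fun do rewrite big_cons.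
by split; [exact: DS.1|rewrite tauM.1// ts].
Qed.

End morphism.

Lemma lattice_psum_ge0 p n (f : 'I_n -> Y) z : lattice_psum p f z -> lle 0 z.
Proof.
move=> [D [tau [DS tauM Dx Dh <-]]].
have [D0 <-] := lattice_morphism0 DS tauM Dh.
by apply: (lattice_morphism_mono tauM D0 Dh) => x; exact: powR_ge0.
Qed.

Lemma lattice_psum_ge p n (f : 'I_n -> Y) z (c : 'I_n -> R) :
  lattice_psum p f z ->
  (forall x : 'I_n -> R, \sum_k c k * x k <= lpnorm p x) ->
  lle (\sum_k c k *: f k) z.
Proof.
move=> [D [tau [DS tauM Dx Dh <-]]] cle.
have [D0 t0] := lattice_morphism0 DS tauM Dh.
have [Dc tc] := lattice_morphism_sum DS tauM c D0 t0 (fun k => (Dx k).1).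
under eq_bigr do rewrite -(Dx _).2.
by rewrite -tc; exact: (lattice_morphism_mono tauM Dc Dh).
Qed.

End lattice_calculus.

Section positive_operators.
Context {R : realType} {d : measure_display} {X : measurableType d}.
Variable mu : {measure set X -> \bar R}.
Context {Y : normedLatticeType R}.
Variable T : Y -> {mfun X >-> R}.
Hypothesis T_linear : ae_linear mu T.
Hypothesis T_positive : positive_operator mu T.

Lemma operator0 : {ae mu, forall x, T 0 x = 0}.
Proof.
have := T_linear 1 0 0; rewrite scale1r addr0.
by apply: filterS => x; rewrite mul1r => /eqP; rewrite -subr_eq subrr => /eqP.
Qed.

Lemma operatorZ (a : R) f : {ae mu, forall x, T (a *: f) x = a * T f x}.
Proof.
have := T_linear a f 0; rewrite addr0; apply: filterS2 operator0 => x T0.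
by rewrite T0 addr0.
Qed.

Lemma operator_sum (I : Type) (s : seq I) (c : I -> R) (f : I -> Y) :
  {ae mu, forall x, T (\sum_(k <- s) c k *: f k) x = \sum_(k <- s) c k * T (f k) x}.
Proof.
elim: s => [|k s ih].
  by rewrite big_nil; apply: filterS operator0 => x ->; rewrite big_nil.
rewrite big_cons; apply: filterS2 ih (T_linear (c k) (f k) (\sum_(k <- s) c k *: f k)) => x ih ->.
by rewrite ih big_cons.
Qed.

Lemma operator_mono f g : lle f g -> {ae mu, forall x, T f x <= T g x}.
Proof.
move=> fg; have := T_linear (-1) f g; rewrite scaleN1r addrC.
apply: filterS2 (T_positive (lle_subr fg)) => x + E.
by rewrite E mulN1r addrC subr_ge0.
Qed.

Lemma operator_labs f : {ae mu, forall x, `|T f x| <= T (labs f) x}.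
Proof.
have h1 := operator_mono (lle_joinl f (- f)).
have h2 := operator_mono (lle_joinr f (- f)).
have := operatorZ (-1) f; rewrite scaleN1r.
apply: filterS3 h1 h2 => x h1 h2 E.
rewrite ler_norml h1 andbT lerNl; apply: le_trans h2.
by rewrite E mulN1r.
Qed.

(** Since z dominates \sum_k c_k f_k for each functional c of norm at most 1 on
l^p, T z dominates \sum_k c_k T f_k outside a null set that depends on c.
Countably many functionals determine the l^p norm on the positive cone, so a
single null set suffices. *)
Lemma operator_psum (p : R) n (f : 'I_n -> Y) (z : Y) : 1 <= p ->
  lattice_psum p f z -> (forall k, lle 0 (f k)) ->
  {ae mu, forall x, 0 <= T z x /\ \sum_k `|T (f k) x| `^ p <= T z x `^ p}.
Proof.
move=> p1 fz f0; have p0 : 0 < p by rewrite (lt_le_trans _ p1).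
have h1 : {ae mu, forall x, forall mi : nat * {ffun 'I_n -> nat},
    \sum_k lpdual p (@grid R n mi) k * T (f k) x <= T z x}.
  apply: ae_forall_countable => mi.
  have a0 k : 0 < @grid R n mi k by rewrite divr_gt0// ltr0n.
  have := operator_mono (lattice_psum_ge fz (lpdual_le p1 a0)).
  by apply: filterS2 (operator_sum (index_enum 'I_n) (lpdual p (@grid R n mi)) f) => x ->.
have h2 : {ae mu, forall x, forall k, 0 <= T (f k) x}.
  by apply: ae_forall_countable => k; exact: T_positive.
apply: filterS3 h1 h2 (T_positive (lattice_psum_ge0 fz)) => x h1 h2 h3.
split=> //; have := lpnorm_le_grid p1 h2 h1; rewrite /lpnorm => H.
have S0 : 0 <= \sum_k `|T (f k) x| `^ p by apply: sumr_ge0 => k _; exact: powR_ge0.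
rewrite -[leLHS](powRr1 S0) -(mulVf (lt0r_neq0 p0)) powRrM.
by apply: ge0_ler_powR; rewrite ?nnegrE ?powR_ge0// ltW.
Qed.

End positive_operators.

(** * Convex hulls of p-th powers *)

Section power_sums.
Context {R : realType} {d : measure_display} {X : measurableType d}.
Variable mu : {measure set X -> \bar R}.
Context {Y : normedLatticeType R}.
Variable T : Y -> {mfun X >-> R}.
Variable p : R.
Hypothesis p_ge1 : 1 <= p.
Hypothesis Y_pconvex : pconvex Y p.
Hypothesis T_linear : ae_linear mu T.
Hypothesis T_positive : positive_operator mu T.
Hypothesis T_saturates : saturates mu T.

Let C := pconvexity_constant Y p.
Let p_gt0 : 0 < p. Proof. by rewrite (lt_le_trans _ p_ge1). Qed.

Let has_inf_pconvex : has_inf [set c : R | 0 <= c /\ pconvex_with Y p c].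
Proof.
split; last by exists 0 => c [].
have [c cY] := Y_pconvex; exists (Num.max 0 c); split.
  by rewrite le_max lexx.
move=> n f; have [z fz zc] := cY n f; exists z => //.
by apply: le_trans zc _; rewrite ler_wpM2r ?powR_ge0// le_max lexx orbT.
Qed.

Lemma pconvexity_constant_ge0 : 0 <= C.
Proof. by apply: lb_le_inf; [exact: has_inf_pconvex.1|move=> c []]. Qed.

Lemma pconvexity_constant_approx (e : R) : 0 < e -> pconvex_with Y p (C + e).
Proof.
move=> e0; have [c [c0 cY] cC] := inf_adherent e0 has_inf_pconvex.
move=> n f; have [z fz zc] := cY n f; exists z => //.
by apply: le_trans zc _; rewrite ler_wpM2r ?powR_ge0// ltW.
Qed.

(** For a single vector, p-convexity compares the norm of f with that of its
modulus, so every admissible constant is at least 1. *)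
Lemma pconvexity_constant_gt0 (f : Y) : f != 0 -> 0 < C.
Proof.
move=> fn0; apply: lt_le_trans ltr01 _.
apply: lb_le_inf; first exact: has_inf_pconvex.1.
move=> c [c0 cY]; have [z fz zc] := cY 1%N (fun=> f).
have f0 : 0 < `|f| by rewrite normr_gt0.
have nz (s : R) : `|s| <= 1 -> lle (s *: f) z.
  move=> s1; have := @lattice_psum_ge _ _ p _ (fun=> f) z (fun=> s) fz.
  rewrite big_ord1; apply => x; rewrite big_ord1 /lpnorm big_ord1.
  rewrite -powRrM divff ?gt_eqF// powRr1//.
  apply: le_trans (ler_norm _) _; rewrite normrM.
  by rewrite ler_piMl.
have labsz : lle (labs f) z.
  apply/ljoin_lub; split; first by rewrite -[f]scale1r; apply: nz; rewrite normr1.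
  by rewrite -scaleN1r; apply: nz; rewrite normrN1.
have : `|f| <= `|z|.
  by apply: ler_lnorm; exact: lle_trans labsz (lle_joinl z (- z)).
move=> /le_trans/(_ zc); rewrite big_ord1 -powRrM divff ?gt_eqF// powRr1//.
by rewrite -{1}[`|f|]mul1r ler_pM2r.
Qed.

(** The convex hull of the functions C^-p |T f|^p with f in the positive part of
the unit ball, with the norms carried by the weights a.1. *)
Definition power_sums : set (X -> R) := [set u | exists s : seq (R * Y),
  [/\ forall a, a \in s -> 0 <= a.1 /\ lle 0 a.2,
      \sum_(a <- s) a.1 * `|a.2| `^ p <= 1 &
      u = fun x => C `^ (- p) * \sum_(a <- s) a.1 * `|T a.2 x| `^ p]].

Let term_ge0 (s : seq (R * Y)) (g : Y -> R) :
  (forall a, a \in s -> 0 <= a.1 /\ lle 0 a.2) ->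
  0 <= \sum_(a <- s) a.1 * `|g a.2| `^ p.
Proof.
move=> s0; rewrite big_seq sumr_ge0// => a /s0[a0 _].
by rewrite mulr_ge0// powR_ge0.
Qed.

Lemma power_sums_nneg u : power_sums u ->
  measurable_fun [set: X] u /\ forall x, 0 <= u x.
Proof.
move=> [s [s0 _ ->]]; split; last first.
  by move=> x; rewrite mulr_ge0 ?powR_ge0// (term_ge0 (fun h => T h x)).
apply: measurable_funM => //; apply: measurable_sum => a.
apply: measurable_funM => //.
apply: (measurableT_comp (@measurable_powR R p)).
exact: measurableT_comp.
Qed.

Lemma power_sums_convex (t : R) u v : 0 <= t <= 1 ->
  power_sums u -> power_sums v ->
  power_sums (fun x => (1 - t) * u x + t * v x).
Proof.
move=> /andP[t0 t1] [su [su0 su1 ->]] [sv [sv0 sv1 ->]].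
have t'0 : 0 <= 1 - t by rewrite subr_ge0.
exists ([seq ((1 - t) * a.1, a.2) | a <- su] ++ [seq (t * a.1, a.2) | a <- sv]).
split.
- move=> a; rewrite mem_cat => /orP[|] /mapP[b bs ->]/=.
    by have [b1 b2] := su0 _ bs; rewrite mulr_ge0.
  by have [b1 b2] := sv0 _ bs; rewrite mulr_ge0.
- rewrite big_cat !big_map/=.
  under eq_bigr do rewrite -mulrA; under [X in _ + X]eq_bigr do rewrite -mulrA.
  rewrite -!mulr_sumr -[leRHS](subrK t) lerD//.
    by rewrite -[leRHS]mulr1 ler_wpM2l.
  by rewrite -[leRHS]mulr1 ler_wpM2l.
- apply/funext => x; rewrite big_cat !big_map/=.
  under [in RHS]eq_bigr do rewrite -mulrA.
  under [X in _ = _ * (_ + X)]eq_bigr do rewrite -mulrA.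
  by rewrite -!mulr_sumr; ring.
Qed.

Lemma power_sums0 : power_sums !=set0.
Proof.
by eexists; exists [::]; split => //; rewrite big_nil.
Qed.

(** The infimum defining C need not be attained, which costs the factor 1 + e. *)
Lemma power_sums_dominated u (e : R) : 0 < C -> 0 < e -> power_sums u ->
  exists F : Y, [/\ lle 0 F, `|F| <= 1 + e &
    {ae mu, forall x, 0 <= T F x /\ u x <= T F x `^ p}].
Proof.
move=> C0 e0 [s [s0 s1 ->]].
pose n := size s; pose a k := (tnth (in_tuple s) k).1.
pose f k := (tnth (in_tuple s) k).2.
have as_ k : tnth (in_tuple s) k \in s by exact: mem_tnth.
have a0 k : 0 <= a k by exact: (s0 _ (as_ k)).1.
have f0 k : lle 0 (f k) by exact: (s0 _ (as_ k)).2.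
pose f' k := a k `^ p^-1 *: f k.
have f'0 k : lle 0 (f' k) by apply: lle_scale => //; exact: powR_ge0.
have apK k : (a k `^ p^-1) `^ p = a k.
  by rewrite -powRrM mulVf ?gt_eqF// powRr1.
have [z fz zc] := pconvexity_constant_approx (mulr_gt0 C0 e0) f'.
have z1 : `|z| <= C * (1 + e).
  apply: le_trans zc _; rewrite mulrDr mulr1.
  rewrite -[leRHS]mulr1 ler_wpM2l//; first by rewrite addr_ge0// ltW// mulr_gt0.
  have one : 1 `^ p^-1 = 1 :> R by rewrite powR1.
  rewrite -[leRHS]one; apply: ge0_ler_powR; rewrite ?nnegrE ?invr_ge0//.
  - exact: ltW.
  - by apply: sumr_ge0 => k _; exact: powR_ge0.
  - apply: le_trans s1; rewrite (big_tnth _ _ s) ler_sum// => k _.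
    by rewrite normrZ ger0_norm ?powR_ge0// powRM ?powR_ge0// apK.
have C'0 : 0 <= C^-1 by rewrite invr_ge0 ltW.
exists (C^-1 *: z); split.
- by apply: lle_scale => //; exact: lattice_psum_ge0 fz.
- by rewrite normrZ ger0_norm// ler_pdivrMl.
- have hf : {ae mu, forall x, forall k, T (f' k) x = a k `^ p^-1 * T (f k) x}.
    by apply: ae_forall_countable => k; exact: operatorZ.
  have hz := operatorZ T_linear C^-1 z.
  have hs := operator_psum T_linear T_positive p_ge1 fz f'0.
  apply: filterS3 hf hz hs => x fx zx [Tz0 sx].
  rewrite zx; split; first by rewrite mulr_ge0.
  rewrite powRM// -powR_inv1 ?(ltW C0)// -powRrM mulN1r.
  rewrite ler_wpM2l ?powR_ge0//; apply: le_trans sx.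
  rewrite (big_tnth _ _ s) ler_sum// => k _.
  by rewrite fx normrM powRM// [`|_ `^ _|]ger0_norm ?powR_ge0// apK.
Qed.

Let power_sum1 (f : Y) (a : R) : 0 <= a -> a * `|f| `^ p <= 1 ->
  power_sums (fun x => C `^ (- p) * (a * `|T (labs f) x| `^ p)).
Proof.
move=> a0 af; exists [:: (a, labs f)]; split.
- by move=> b; rewrite inE => /eqP ->; split => //; exact: labs_ge0.
- by rewrite big_seq1/= norm_labs.
- by apply/funext => x; rewrite big_seq1.
Qed.

Lemma power_sums_exhaust : 0 < C -> sigma_finite [set: X] mu ->
  exists w : nat -> X -> R, [/\ forall n, power_sums (w n),
    forall n x, 0 < w n x -> 0 < w n.+1 x &
    {ae mu, forall x, exists n, 0 < w n x}].
Proof.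
move=> C0 sf; apply: exhausting_sequence => //.
- exact: power_sums0.
- exact: power_sums_nneg.
- exact: power_sums_convex.
move=> E mE muE; have [E' [mE' E'E muE' [h hE']]] := T_saturates mE muE.
have N0 : 0 < 1 + `|h| `^ p by rewrite ltr_wpDr// powR_ge0.
exists E', (fun x => C `^ (- p) * ((1 + `|h| `^ p)^-1 * `|T (labs h) x| `^ p)).
split => //.
  apply: power_sum1; first by rewrite invr_ge0 ltW.
  by rewrite mulrC ler_pdivrMr// mul1r lerDr.
apply: filterS2 hE' (operator_labs T_linear T_positive h) => x hx habs Ex.
rewrite mulr_gt0 ?powR_gt0// mulr_gt0 ?invr_gt0// powR_gt0//.
by rewrite normr_gt0 gt_eqF// (lt_le_trans (hx Ex)).
Qed.

(** The hypothesis is used for the power sum with one term: the modulus of f,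
with weight `|f|^-p. *)
Lemma power_sums_bound (rho : X -> R) (A : R) : 0 < C -> 0 <= A ->
  measurable_fun [set: X] rho -> (forall x, 0 <= rho x) ->
  (forall v, power_sums v -> \int[mu]_x (v x * rho x)%:E <= A%:E)%E ->
  forall f : Y, ((\int[mu]_x (`|T f x| `^ p * rho x)%:E) `^ p^-1 <=
    (A `^ p^-1 * C * `|f|)%:E)%E.
Proof.
move=> C0 A0 mrho rho0 Arho f.
have mpow (h : Y) : measurable_fun [set: X] (fun x => `|T h x| `^ p).
  apply: (measurableT_comp (@measurable_powR R p)); exact: measurableT_comp.
have mint (h : Y) : measurable_fun [set: X] (fun x => `|T h x| `^ p * rho x).
  exact: measurable_funM.
have int0 (h : Y) x : 0 <= `|T h x| `^ p * rho x by rewrite mulr_ge0 ?powR_ge0.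
have [->|fn0] := eqVneq f 0.
  have -> : (\int[mu]_x (`|T 0 x| `^ p * rho x)%:E = 0)%E.
    apply/eqP; rewrite eq_le; apply/andP; split; last first.
      by apply: integral_ge0 => x _; rewrite lee_fin.
    rewrite -(integral0 mu [set: X]); apply: le_integral_EFin => //.
    apply: filterS (operator0 T_linear) => x ->.
    by rewrite normr0 powR0 ?gt_eqF// mul0r.
  by rewrite normr0 mulr0 poweR0r// invr_eq0 gt_eqF.
have f0 : 0 < `|f| by rewrite normr_gt0.
pose k := C `^ p * `|f| `^ p.
have k0 : 0 < k by rewrite mulr_gt0// powR_gt0.
have kE : (A `^ p^-1 * C * `|f|)  = (k * A) `^ p^-1.
  rewrite !powRM ?powR_ge0 ?mulr_ge0 ?powR_ge0//.
  by rewrite -!powRrM divff ?gt_eqF// !powRr1 ?(ltW C0)//; ring.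
rewrite kE -poweR_EFin; apply: gt0_ler_poweR; rewrite ?invr_ge0 ?(ltW p_gt0)//.
- by rewrite in_itv/= leey andbT integral_ge0// => x _; rewrite lee_fin.
- by rewrite in_itv/= leey andbT lee_fin mulr_ge0// ltW.
pose v x := C `^ (- p) * (`|f| `^ (- p) * `|T (labs f) x| `^ p).
have Kv : power_sums v.
  apply: power_sum1; first exact: powR_ge0.
  by rewrite powRN mulVf// gt_eqF// powR_gt0.
have [mv v0] := power_sums_nneg Kv.
rewrite EFinM; apply: le_trans (lee_wpmul2l _ (Arho _ Kv)); last first.
  by rewrite lee_fin ltW.
rewrite -integralZ_nneg ?(ltW k0)//; last 2 first.
- exact: measurable_funM.
- by move=> x; rewrite mulr_ge0.
apply: le_integral_EFin => //.
- by apply: measurable_funM => //; exact: measurable_funM.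
- by move=> x; rewrite mulr_ge0 ?(ltW k0)// mulr_ge0.
- apply: filterS (operator_labs T_linear T_positive f) => x habs.
  have -> : k * (v x * rho x) = `|T (labs f) x| `^ p * rho x.
    rewrite /k /v !powRN; field.
    by rewrite !gt_eqF ?powR_gt0.
  rewrite ler_wpM2r//; apply: ge0_ler_powR; rewrite ?nnegrE ?(ltW p_gt0)//.
  by apply: le_trans habs _; exact: ler_norm.
Qed.

End power_sums.

(** * Auxiliary inequalities *)

Section auxiliary.
Context {R : realType} {d : measure_display} {X : measurableType d}.
Variable mu : {measure set X -> \bar R}.

Lemma big_option (S : Type) (idx : S) (op : Monoid.com_law idx) (I : finType)
    (F : option I -> S) :
  \big[op/idx]_j F j = op (F None) (\big[op/idx]_j F (Some j)).
Proof.
rewrite (bigD1 None)//=; congr (op _ _).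
rewrite (reindex_omap Some id) => [|[]//].
by apply: eq_bigl => j /=; rewrite eqxx.
Qed.

Lemma mfun_family (I : Type) (f : I -> X -> R) :
  (forall j, measurable_fun [set: X] (f j)) ->
  exists g : I -> {mfun X >-> R}, forall j x, g j x = f j x.
Proof.
move=> mf.
pose g j : {mfun X >-> R} :=
  HB.pack (f j) (isMeasurableFun.Build _ _ _ _ (f j) (mf j)).
by exists g.
Qed.

Lemma powR_prod (I : finType) (f : I -> R) (r : R) : (forall j, 0 <= f j) ->
  (\prod_j f j) `^ r = \prod_j f j `^ r.
Proof.
move=> f0.
pose Q (x y : R) := 0 <= x /\ x `^ r = y.
suff [] : Q (\prod_j f j) (\prod_j f j `^ r) by [].
apply: (big_rec2 Q); first by split; rewrite ?powR1.
by move=> j y x _ [x0 <-]; split; [exact: mulr_ge0|rewrite powRM].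
Qed.

Lemma lee_limit_scale (A : \bar R) (N P : R) : 0 < P ->
  (forall e, 0 < e -> (A <= (N * (1 + e) `^ P)%:E)%E) -> (A <= N%:E)%E.
Proof.
move=> P0 H; case: A H => [r H||]; last by rewrite leNye.
- rewrite lee_fin.
  have hc : N * (1 + harmonic n) `^ P @[n --> \oo] --> N * (1 + 0) `^ P.
    apply: (cvgM (cvg_cst _)); apply: cvg_powR => //.
    - by move=> n; rewrite addr_ge0// invr_ge0.
    - exact: (cvgD (cvg_cst _) cvg_harmonic).
  move: hc; rewrite addr0 powR1 mulr1 => hc.
  rewrite -(cvg_lim _ hc)//; apply: limr_ge; first by apply/cvg_ex; exists N.
  apply: nearW => n; rewrite -lee_fin; apply: H.
  by rewrite invr_gt0 ltr0n.
- by move=> /(_ 1 ltr01); rewrite leye_eq.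
Qed.

Lemma hoelder_conjugate_EFin (r : R) : r != 0 -> r != 1 ->
  hoelder_conjugate r%:E = (r / (r - 1))%:E.
Proof.
move=> r0 r1; rewrite /hoelder_conjugate/= eqe (negbTE r0).
by rewrite -EFinB inver subr_eq0 (negbTE r1).
Qed.

Lemma integral_le_hoelder (q : \bar R) (f g : X -> R) (M : R) : (1 < q)%E ->
  measurable_fun [set: X] f -> measurable_fun [set: X] g ->
  (forall x, 0 <= f x) -> (forall x, 0 <= g x) -> 0 <= M ->
  ('N[mu]_q [EFin \o f] <= M%:E)%E ->
  (\int[mu]_x (f x * g x)%:E <=
    M%:E * 'N[mu]_(hoelder_conjugate q) [EFin \o g])%E.
Proof.
move=> q1 mf mg f0 g0 M0 fM; case: q q1 fM => [r||]//.
- rewrite lte_fin => r1 fM; have r0 : 0 < r by rewrite (lt_trans _ r1).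
  rewrite hoelder_conjugate_EFin ?gt_eqF//.
  have r10 : 0 < r - 1 by rewrite subr_gt0.
  have := hoelder mu mf mg r0 (divr_gt0 r0 r10).
  rewrite Lnorm1 => /(_ _)/le_trans H.
  apply: (@le_trans _ _ (\int[mu]_x `|(EFin \o (f \* g)%R) x|)%E).
    rewrite le_eqVlt; apply/orP; left; apply/eqP; apply: eq_integral => x _.
    by rewrite gee0_abs// lee_fin mulr_ge0.
  apply: H; first by field; rewrite !gt_eqF.
  by apply: lee_wpmul2r => //; exact: Lnorm_ge0.
- move=> _; rewrite hoelder_conjugatey Lnorm1 => fM.
  have -> : (\int[mu]_x `|(EFin \o g) x| = \int[mu]_x (g x)%:E)%E.
    by apply: eq_integral => x _; rewrite gee0_abs// lee_fin.
  rewrite -integralZ_nneg//; apply: le_integral_EFin => //.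
  + exact: measurable_funM.
  + exact: measurable_funM.
  + by move=> x; rewrite mulr_ge0.
  + by move=> x; rewrite mulr_ge0.
  move: fM; rewrite unlock; case: ifPn => [_|].
    move=> /ess_supP; apply: filterS => x /=.
    by rewrite lee_fin ger0_norm// => fx; rewrite ler_wpM2r.
  rewrite -leNgt => muX _; have muX0 : mu [set: X] = 0%E.
    by apply/eqP; rewrite eq_le muX measure_ge0.
  by exists [set: X]; split.
Qed.

End auxiliary.

(** * The three cases *)

Section factorisation.
Context (R : realType) (disp : measure_display)
  (X : measurableType disp) (mu : {measure set X -> \bar R})
  (d : nat) (Y : 'I_d -> normedLatticeType R) (p theta : 'I_d -> R)
  (T : forall j : 'I_d, Y j -> {mfun X >-> R}) (q : \bar R) (B : R).
Arguments T : clear implicits.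
Hypothesis p_ge1 : forall j, 1 <= p j.
Hypothesis Y_pconvex : forall j, pconvex (Y j) (p j).
Hypothesis T_linear : forall j, ae_linear mu (T j).
Hypothesis T_positive : forall j, positive_operator mu (T j).
Hypothesis T_saturates : forall j, saturates mu (T j).
Hypothesis theta_gt0 : forall j, 0 < theta j.
Hypothesis theta_sum : \sum_j theta j = 1.
Hypothesis q_gt0 : (0 < q)%E.
Hypothesis T_bound : forall f : (forall j, Y j), (forall j, lle 0 (f j)) ->
    ('N[mu]_q [(fun x => (\prod_j T j (f j) x `^ (p j * theta j))%:E)] <=
     (B * \prod_j `|f j| `^ (p j * theta j))%:E)%E.
Arguments T_linear : clear implicits.
Arguments T_positive : clear implicits.
Arguments T_saturates : clear implicits.
Arguments Y_pconvex : clear implicits.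

Let C j := pconvexity_constant (Y j) (p j).
Let K j := power_sums (T j) (p j).

Let p_gt0 j : 0 < p j. Proof. by rewrite (lt_le_trans _ (p_ge1 j)). Qed.
Let pth_gt0 j : 0 < p j * theta j. Proof. by rewrite mulr_gt0. Qed.
Hypothesis mu_sf : sigma_finite [set: X] mu.

Let P : R := \sum_j p j * theta j.

Let P_gt0 : 0 < P.
Proof.
apply: (@lt_le_trans _ _ 1) => //; rewrite -theta_sum ler_sum// => j _.
by rewrite -[leLHS]mul1r ler_wpM2r// ltW.
Qed.

Section trivial_factor.
Variable j0 : 'I_d.
Hypothesis Y0 : forall f : Y j0, f = 0.

(** An operator on the zero space cannot saturate a set of positive measure. *)
Lemma trivial_factor_null : mu [set: X] = 0%E.
Proof.
apply/eqP; rewrite eq_le measure_ge0 andbT leNgt; apply/negP => muX.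
have [E [mE _ muE [h hE]]] := T_saturates j0 _ measurableT muX.
have : {ae mu, forall x, ~ E x}.
  apply: filterS2 hE (operator0 (T_linear j0)) => x hx T0 /hx.
  by rewrite (Y0 h) T0 normr0 ltxx.
by move=> /(ae_notin_measure0 mE) E0; rewrite E0 ltxx in muE.
Qed.

End trivial_factor.

Section nontrivial_factors.
Hypothesis Yn0 : forall j, exists f : Y j, f != 0.

Let C_gt0 j : 0 < C j.
Proof. by have [f f0] := Yn0 j; exact: pconvexity_constant_gt0 f0. Qed.

(* both sides of the hypothesis at nonzero vectors; on zero spaces B may be
   negative *)
Let B_ge0 : 0 <= B.
Proof.
pose f j : Y j := sval (cid (Yn0 j)).
have fn0 j : f j != 0 by rewrite /f; case: cid.
rewrite leNgt; apply/negP => Bn.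
have := le_trans (Lnorm_ge0 _ _ _) (T_bound (fun j => labs_ge0 (f j))).
rewrite lee_fin leNgt nmulr_rlt0//; apply/negP; rewrite negbK.
by apply: prodr_gt0 => j _; rewrite norm_labs powR_gt0// normr_gt0 fn0.
Qed.

Let K_nneg j u : K j u -> measurable_fun [set: X] u /\ forall x, 0 <= u x.
Proof. exact: power_sums_nneg. Qed.

Let K_convex j t u v : 0 <= t <= 1 -> K j u -> K j v ->
  K j (fun x => (1 - t) * u x + t * v x).
Proof. exact: power_sums_convex. Qed.

Let mprod (F : forall j, Y j) : measurable_fun [set: X]
  (fun x => \prod_j T j (F j) x `^ (p j * theta j)).
Proof.
apply: measurable_prod => j _.
exact: (measurableT_comp (@measurable_powR R (p j * theta j))).
Qed.

Let prod0 (F : forall j, Y j) x :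
  0 <= \prod_j T j (F j) x `^ (p j * theta j).
Proof. by apply: prodr_ge0 => j _; exact: powR_ge0. Qed.

(** Transfers the hypothesis from the operators to the power sums. *)
Lemma gmean_power_sums_dominated (u : 'I_d -> X -> R) (e : R) : 0 < e ->
  (forall j, K j (u j)) -> exists F : forall j, Y j,
    ('N[mu]_q [(fun x => (\prod_j T j (F j) x `^ (p j * theta j))%:E)] <=
     (B * (1 + e) `^ P)%:E)%E /\
    {ae mu, forall x,
      gmean theta (u^~ x) <= \prod_j T j (F j) x `^ (p j * theta j)}.
Proof.
move=> e0 Ku; have e1 : 0 < 1 + e by rewrite addr_gt0.
have domF j := power_sums_dominated (p_ge1 j) (Y_pconvex j) (T_linear j)
  (T_positive j) (C_gt0 j) e0 (Ku j).
pose F j : Y j := sval (cid (domF j)).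
have [F0 F1 Fu] : [/\ forall j, lle 0 (F j), forall j, `|F j| <= 1 + e &
    forall j, {ae mu, forall x, 0 <= T j (F j) x /\ u j x <= T j (F j) x `^ p j}].
  by split=> j; rewrite /F; case: cid => ? [].
exists F; split.
  apply: le_trans (T_bound F0) _; rewrite lee_fin ler_wpM2l//.
  apply: (@le_trans _ _ (\prod_j (1 + e) `^ (p j * theta j))).
    apply: ler_prod => j _; rewrite powR_ge0/=.
    by apply: ge0_ler_powR; rewrite ?nnegrE ?(ltW (pth_gt0 j)) ?(ltW e1).
  under eq_bigr do rewrite /powR gt_eqF//.
  by rewrite -expR_sum -mulr_suml /powR gt_eqF.
have := ae_forall_countable Fu; apply: filterS => x Fx.
apply: ler_prod => j _; rewrite powR_ge0/= powRrM.
have [TF0 uF] := Fx j; have [_ u0] := K_nneg (Ku j).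
by apply: ge0_ler_powR; rewrite ?nnegrE ?(ltW (theta_gt0 j))// powR_ge0.
Qed.

Lemma exhausting_power_sums : exists w : nat -> 'I_d -> X -> R,
  [/\ forall n j, K j (w n j),
    forall n, positivity_set (w n) `<=` positivity_set (w n.+1) &
    {ae mu, forall x, exists n, positivity_set (w n) x}].
Proof.
have /choice[w wP] : forall j, exists w : nat -> X -> R,
    [/\ forall n, K j (w n), forall n x, 0 < w n x -> 0 < w n.+1 x &
     {ae mu, forall x, exists n, 0 < w n x}].
  move=> j; exact: (power_sums_exhaust (T_linear j)
    (T_positive j) (T_saturates j) (C_gt0 j) mu_sf).
exists (fun n j => w j n); split.
- by move=> n j; have [] := wP j.
- by move=> n x wx j; have [_ + _] := wP j; apply; exact: wx.
have : {ae mu, forall x, forall j, exists n, 0 < w j n x}.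
  by apply: ae_forall_countable => j; have [] := wP j.
apply: filterS => x /choice[n wn].
have mono j m m' : (m <= m')%N -> 0 < w j m x -> 0 < w j m' x.
  move=> /subnK <-; elim: (m' - m)%N => [|k ih]; first by rewrite add0n.
  by move=> /ih; rewrite addSn; have [_ + _] := wP j; apply.
exists (\max_j n j) => j.
by apply: mono (wn j); exact: leq_bigmax.
Qed.

Lemma case_disentanglement : q = 1%E ->
  exists phi : 'I_d -> {mfun X >-> R},
  [/\ forall j x, 0 <= phi j x,
      {ae mu, forall x, 1 <= \prod_j phi j x `^ theta j} &
      forall j (f : Y j),
        ((\int[mu]_x (`|T j f x| `^ p j * phi j x)%:E) `^ (p j)^-1 <=
         (B `^ (p j)^-1 * C j * `|f|)%:E)%E].
Proof.
move=> q1; have [w [Kw wS wT]] := exhausting_power_sums.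
have Kb (u : 'I_d -> X -> R) : (forall j, K j (u j)) ->
    (\int[mu]_x (gmean theta (u^~ x))%:E <= B%:E)%E.
  move=> Ku; apply: (lee_limit_scale P_gt0) => e e0.
  have [F [FB uF]] := gmean_power_sums_dominated e0 Ku.
  apply: le_trans FB; rewrite q1 Lnorm1.
  have -> : (\int[mu]_x `|(\prod_j T j (F j) x `^ (p j * theta j))%:E| =
    \int[mu]_x (\prod_j T j (F j) x `^ (p j * theta j))%:E)%E.
    by apply: eq_integral => x _; rewrite gee0_abs// lee_fin.
  apply: le_integral_EFin => //.
  - by apply: measurable_gmean => j; exact: (K_nneg (Ku j)).1.
  - by move=> x; exact: gmean_ge0.
have [phi [mphi phi0 phi1 phiK]] :=
  disentanglement theta_gt0 theta_sum K_nneg K_convex Kb mu_sf Kw wS.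
have [g gE] := mfun_family mphi.
exists g; split.
- by move=> j x; rewrite gE.
- apply: filterS2 phi1 wT => x + wx => /(_ wx).
  by rewrite /gmean; under eq_bigr do rewrite -gE.
- move=> j f; under eq_integral do rewrite gE.
  exact: (power_sums_bound (p_ge1 j) (T_linear j)
    (T_positive j) (C_gt0 j) B_ge0 (mphi j) (phi0 j) (phiK j)).
Qed.

Lemma case_duality : (1 < q)%E -> forall G : X -> R, (forall x, 0 <= G x) ->
  G \in Lfun mu (hoelder_conjugate q) ->
  exists g : 'I_d -> {mfun X >-> R},
  [/\ forall j x, 0 <= g j x,
      {ae mu, forall x, G x <= \prod_j g j x `^ theta j} &
      forall j (f : Y j),
        ((\int[mu]_x (`|T j f x| `^ p j * g j x)%:E) `^ (p j)^-1 <=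
         (B `^ (p j)^-1 * C j)%:E *
         'N[mu]_(hoelder_conjugate q) [EFin \o G] `^ (p j)^-1 *
         `|f|%:E)%E].
Proof.
move=> q1 G G0 LG.
have mG : measurable_fun [set: X] G by exact: (set_mem (sub_Lfun_mfun LG)).
have Gfin : ('N[mu]_(hoelder_conjugate q) [EFin \o G] < +oo)%E.
  by have /set_mem := sub_Lfun_finLfun LG.
pose N := fine ('N[mu]_(hoelder_conjugate q) [EFin \o G])%E.
have NE : ('N[mu]_(hoelder_conjugate q) [EFin \o G] = N%:E)%E.
  by rewrite fineK// ge0_fin_numE// Lnorm_ge0.
have N0 : 0 <= N by rewrite -lee_fin -NE Lnorm_ge0.
have [w [Kw wS wT]] := exhausting_power_sums.
pose KG j : set (X -> R) := [set u | exists2 v, K j v & u = fun x => G x * v x].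
have KG_nneg j u : KG j u -> measurable_fun [set: X] u /\ forall x, 0 <= u x.
  move=> [v Kv ->]; have [mv v0] := K_nneg Kv; split.
    exact: measurable_funM.
  by move=> x; rewrite mulr_ge0.
have KG_convex j t u v : 0 <= t <= 1 -> KG j u -> KG j v ->
    KG j (fun x => (1 - t) * u x + t * v x).
  move=> t01 [u' Ku ->] [v' Kv ->].
  exists (fun x => (1 - t) * u' x + t * v' x); first exact: K_convex.
  by apply/funext => x; ring.
have Kb (u : 'I_d -> X -> R) : (forall j, KG j (u j)) ->
    (\int[mu]_x (gmean theta (u^~ x))%:E <= (B * N)%:E)%E.
  move=> KGu; apply: (lee_limit_scale P_gt0) => e e0.
  have /choice[v vP] : forall j, exists v, K j v /\ u j = fun x => G x * v x.
    by move=> j; have [v Kv uE] := KGu j; exists v.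
  have Kv j : K j (v j) := (vP j).1.
  have [F [FB uF]] := gmean_power_sums_dominated e0 Kv.
  pose H x := \prod_j T j (F j) x `^ (p j * theta j).
  apply: (@le_trans _ _ (\int[mu]_x (H x * G x)%:E)%E).
    apply: le_integral_EFin.
    - by apply: measurable_gmean => j; exact: (KG_nneg _ _ (KGu j)).1.
    - by apply: measurable_funM => //; exact: mprod.
    - by move=> x; exact: gmean_ge0.
    - by move=> x; rewrite mulr_ge0// prod0.
    - apply: filterS uF => x uFx; rewrite mulrC.
      have -> : u^~ x = fun j => G x * v j x.
        by apply/funext => j; rewrite (vP j).2.
      rewrite gmeanZ//; last by move=> j; exact: (K_nneg (Kv j)).2.
      by rewrite ler_wpM2l.
  apply: le_trans (integral_le_hoelder q1 (mprod F) mG (prod0 F) G0 _ FB) _.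
    by rewrite mulr_ge0// powR_ge0.
  by rewrite NE -EFinM lee_fin mulrAC.
have [n j|n x wx j|phi [mphi phi0 phi1 phiK]] :=
  @disentanglement _ _ _ mu _ theta theta_gt0 theta_sum KG KG_nneg KG_convex
    (B * N) Kb mu_sf (fun n j x => G x * w n j x).
- by exists (w n j).
- have Gw := wx j.
  have Gx : 0 < G x.
    by rewrite lt0r G0 andbT; apply: contraTneq Gw => ->; rewrite mul0r ltxx.
  rewrite mulr_gt0//; apply: (wS n x) => i.
  by have := wx i; rewrite pmulr_rgt0.
have mg j : measurable_fun [set: X] (fun x => G x * phi j x).
  exact: measurable_funM.
have g0 j x : 0 <= G x * phi j x by rewrite mulr_ge0.
have [g gE] := mfun_family mg.
exists g; split.
- by move=> j x; rewrite gE.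
- apply: filterS2 phi1 wT => x phi1 [n wx].
  have -> : \prod_j g j x `^ theta j = gmean theta (fun j => G x * phi j x).
    by apply: eq_bigr => j _; rewrite gE.
  rewrite gmeanZ//; have [->|Gn0] := eqVneq (G x) 0; first by rewrite mul0r.
  have Gx : 0 < G x by rewrite lt0r Gn0 G0.
  rewrite -[leLHS]mulr1 ler_wpM2l//; apply: phi1.
  by exists n => j; rewrite mulr_gt0.
- move=> j f; under eq_integral do rewrite gE.
  have := power_sums_bound (p_ge1 j) (T_linear j)
    (T_positive j) (C_gt0 j) (mulr_ge0 B_ge0 N0) (mg j) (g0 j).
  have Kphi v : K j v -> (\int[mu]_x (v x * (G x * phi j x))%:E <= (B * N)%:E)%E.
    move=> Kv; have := phiK j (fun x => G x * v x); rewrite /=.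
    move=> /(_ (ex_intro2 _ _ v Kv erefl)).
    by under eq_integral do rewrite -mulrA mulrCA.
  move=> /(_ Kphi f)/le_trans; apply.
  rewrite NE poweR_EFin -!EFinM lee_fin powRM//.
  by rewrite [X in X * _ <= _]mulrAC.
Qed.

(** One more factor with exponent 1 - q, restricted to functions with values in
[0, 1], turns the bound in L^q into a bound in L^1.  Its weight psi controls the
power q' of the geometric mean gm of the other weights. *)
Lemma case_factorisation : (q < 1)%E -> (0 < mu [set: X])%E ->
  exists g : 'I_d -> {mfun X >-> R},
  [/\ forall j x, 0 <= g j x,
      pow_norm mu (fine (hoelder_conjugate q))
        (fun x => \prod_j g j x `^ theta j) = 1%E &
      forall j (f : Y j),
        ((\int[mu]_x (`|T j f x| `^ p j * g j x)%:E) `^ (p j)^-1 <=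
         (B `^ (p j)^-1 * C j * `|f|)%:E)%E].
Proof.
move=> q1 muX; have [w [Kw wS wT]] := exhausting_power_sums.
have [r qE] : exists r, q = r%:E.
  by case: q q_gt0 q1 => [r||]// _ _; exists r.
have r0 : 0 < r by rewrite -lte_fin -qE.
have r1 : r < 1 by rewrite -lte_fin -qE.
have r10 : 0 < 1 - r by rewrite subr_gt0.
have r0n : r != 0 by rewrite gt_eqF.
have r10n : 1 - r != 0 by rewrite gt_eqF.
have r1n : r - 1 != 0 by rewrite lt_eqF// subr_lt0.
pose th (o : option 'I_d) := if o is Some j then r * theta j else 1 - r.
have th_gt0 o : 0 < th o by case: o => [j|]//=; rewrite mulr_gt0.
have th_sum : \sum_o th o = 1.
  by rewrite big_option/= -mulr_sumr theta_sum mulr1 subrK.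
pose Ko (o : option 'I_d) : set (X -> R) := if o is Some j then K j else
  [set u : X -> R | measurable_fun [set: X] u /\ forall x, 0 <= u x <= 1].
have Ko_nneg o u : Ko o u -> measurable_fun [set: X] u /\ forall x, 0 <= u x.
  case: o => [j|]; first exact: K_nneg.
  by move=> [mu_ u01]; split => // x; have /andP[] := u01 x.
have Ko_convex o t u v : 0 <= t <= 1 -> Ko o u -> Ko o v ->
    Ko o (fun x => (1 - t) * u x + t * v x).
  case: o => [j|]; first exact: K_convex.
  move=> /andP[t0 t1] [mu_ u01] [mv v01]; split.
    by apply: measurable_funD; exact: measurable_funM.
  have t'0 : 0 <= 1 - t by rewrite subr_ge0.
  move=> x; have /andP[u0 u1] := u01 x; have /andP[v0 v1] := v01 x.
  rewrite addr_ge0 ?mulr_ge0//= -[leRHS](subrK t).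
  by rewrite lerD// ler_piMr.
have gmE (u : option 'I_d -> R) : gmean th u =
    gmean theta (fun j => u (Some j)) `^ r * u None `^ (1 - r).
  rewrite /gmean big_option/= mulrC; congr (_ * _).
  rewrite powR_prod => [|j]; last exact: powR_ge0.
  by apply: eq_bigr => j _; rewrite -powRrM [theta j * r]mulrC.
have Kb (u : option 'I_d -> X -> R) : (forall o, Ko o (u o)) ->
    (\int[mu]_x (gmean th (u^~ x))%:E <= (B `^ r)%:E)%E.
  move=> Ku; apply: (lee_limit_scale (mulr_gt0 P_gt0 r0)) => e e0.
  have [F [FB uF]] := gmean_power_sums_dominated e0 (fun j => Ku (Some j)).
  pose H x := \prod_j T j (F j) x `^ (p j * theta j).
  have HB : (\int[mu]_x (H x `^ r)%:E <= (B `^ r * (1 + e) `^ (P * r))%:E)%E.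
    have -> : (\int[mu]_x (H x `^ r)%:E = \int[mu]_x (`|(H x)%:E| `^ r))%E.
      by apply: eq_integral => x _; rewrite gee0_abs ?poweR_EFin// lee_fin prod0.
    rewrite -poweR_Lnorm ?gt_eqF//.
    have e1 : 0 < 1 + e by rewrite addr_gt0.
    rewrite powRrM -powRM ?powR_ge0// -poweR_EFin.
    apply: gt0_ler_poweR; rewrite ?(ltW r0)//.
    - by rewrite in_itv/= leey andbT Lnorm_ge0.
    - by rewrite in_itv/= leey andbT lee_fin mulr_ge0// powR_ge0.
    - by rewrite -qE.
  apply: le_trans HB; apply: le_integral_EFin.
  - by apply: measurable_gmean => o; exact: (Ko_nneg _ _ (Ku o)).1.
  - exact: (measurableT_comp (@measurable_powR R r) (mprod F)).
  - by move=> x; exact: gmean_ge0.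
  - by move=> x; exact: powR_ge0.
  - apply: filterS uF => x uFx; rewrite gmE.
    have [_ /(_ x)/andP[u0 u1]] := Ku None.
    apply: (@le_trans _ _ (gmean theta (fun j => u (Some j) x) `^ r)).
      rewrite ler_piMr ?powR_ge0//.
      have one : 1 `^ (1 - r) = 1 :> R by rewrite powR1.
      by rewrite -[leRHS]one; apply: ge0_ler_powR; rewrite ?nnegrE ?(ltW r10).
    apply: ge0_ler_powR; rewrite ?nnegrE ?(ltW r0) ?gmean_ge0//.
have K1 : Ko None (fun=> 1).
  by split; [exact: measurable_cst|move=> x; rewrite ler01 lexx].
have [n [j|]|n x wx [j|]|phi [mphi phi0 phi1 phiK]] :=
  @disentanglement _ _ _ mu _ th th_gt0 th_sum Ko Ko_nneg Ko_convex
    (B `^ r) Kb mu_sf (fun n o => if o is Some j then w n j else fun=> 1).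
- exact: Kw.
- exact: K1.
- by apply: (wS n x) => i; exact: (wx (Some i)).
- exact: ltr01.
pose gm x := gmean theta (fun j => phi (Some j) x).
have gm0 x : 0 <= gm x by exact: gmean_ge0.
have mgm : measurable_fun [set: X] gm by apply: measurable_gmean => j; exact: mphi.
pose s := r / (r - 1).
have s0 : s < 0 by rewrite /s pmulr_rlt0// invr_lt0 subr_lt0.
have sE : fine (hoelder_conjugate q) = s.
  by rewrite qE hoelder_conjugate_EFin ?(gt_eqF r0) ?(lt_eqF r1).
pose h x : \bar R := epow (gm x)%:E s.
have hE x : h x = if gm x == 0 then +oo%E else ((gm x `^ (- s))^-1)%:E.
  rewrite /h /epow s0 poweR_EFin inver powR_eq0 oppr_eq0 (lt_eqF s0) andbT.
  by [].
have h_gt0 x : (0 < h x)%E.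
  rewrite hE; case: eqP => [_|/eqP gn0]; first exact: lt0y.
  by rewrite lte_fin invr_gt0 powR_gt0// lt0r gn0 gm0.
have mh : measurable_fun [set: X] h.
  rewrite (_ : h = fun x => if gm x == 0 then +oo%E else ((gm x `^ (- s))^-1)%:E).
    apply: measurable_fun_ifT.
    - by apply: measurable_fun_eqr => //; exact: measurable_cst.
    - exact: measurable_cst.
    - apply/measurable_EFinP; apply: measurable_inv_nneg.
        exact: (measurableT_comp (@measurable_powR R (- s)) mgm).
      by move=> x; exact: powR_ge0.
  by apply/funext.
(* gm^r psi^(1-r) >= 1, raised to the power 1/(1-r) *)
have hphi : {ae mu, forall x, (h x <= (phi None x)%:E)%E}.
  apply: filterS2 phi1 wT => x phi1 [n wx].
  have {phi1} : 1 <= gmean th (phi^~ x).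
    by apply: phi1; exists n => -[j|]; [exact: wx|exact: ltr01].
  rewrite gmE -/(gm x) => ge1.
  have gn0 : gm x != 0.
    apply: contraTneq ge1 => ->; rewrite powR0 ?gt_eqF// mul0r -ltNge.
    exact: ltr01.
  have psi0 : 0 <= phi None x by exact: phi0.
  rewrite hE (negbTE gn0) lee_fin.
  have gx : 0 < gm x by rewrite lt0r gn0 gm0.
  have gs0 : 0 < gm x `^ (- s) by rewrite powR_gt0.
  have : 1 <= gm x `^ (- s) * phi None x.
    have -> : gm x `^ (- s) * phi None x =
        (gm x `^ r * phi None x `^ (1 - r)) `^ (1 - r)^-1.
      rewrite powRM ?powR_ge0// -!powRrM divff ?gt_eqF// powRr1//.
      congr (_ `^ _ * _); rewrite /s; field.
      by rewrite ?r1n ?r10n ?r0n.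
    have one : 1 `^ (1 - r)^-1 = 1 :> R by rewrite powR1.
    rewrite -[leLHS]one; apply: ge0_ler_powR; rewrite ?nnegrE ?invr_ge0 ?(ltW r10)//.
    by rewrite mulr_ge0// powR_ge0.
  by rewrite -ler_pdivrMl// mulr1.
have hB : (\int[mu]_x h x <= (B `^ r)%:E)%E.
  apply: (@le_trans _ _ (\int[mu]_x (phi None x)%:E)%E).
    apply: ae_ge0_le_integral => //.
    - by move=> x _; exact: ltW.
    - by move=> x _; rewrite lee_fin.
    - exact/measurable_EFinP.
    - by apply: filterS hphi => x hx _.
  have := phiK None (fun=> 1) K1.
  by under eq_integral do rewrite mul1r.
have h_ge0 : (0 <= \int[mu]_x h x)%E by apply: integral_ge0 => x _; exact: ltW.
pose m := fine (\int[mu]_x h x)%E.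
have mE : (\int[mu]_x h x = m%:E)%E.
  by rewrite fineK// ge0_fin_numE//; exact: le_lt_trans hB (ltry _).
have mB : m <= B `^ r by rewrite -lee_fin -mE.
have m_gt0 : 0 < m.
  rewrite lt0r -lee_fin -mE h_ge0 andbT; apply/eqP => m0.
  have : (\int[mu]_x `|h x| = 0)%E.
    transitivity (\int[mu]_x h x)%E; last by rewrite mE m0.
    by apply: eq_integral => x _; rewrite gee0_abs// ltW.
  move=> /(ae_eq_integral_abs mu measurableT mh) h0.
  have : {ae mu, forall x, ~ [set: X] x}.
    apply: filterS h0 => x /(_ Logic.I) hx _.
    by have := h_gt0 x; rewrite hx ltxx.
  by move=> /(ae_notin_measure0 measurableT) X0; rewrite X0 ltxx in muX.
(* the factor with c^s m = 1; it is at most B^(1-r) because m <= B^r *)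
pose c := m `^ ((1 - r) / r).
have c0 : 0 < c by rewrite powR_gt0.
have cB : c * B `^ r <= B.
  have c1 : c <= B `^ (1 - r).
    have -> : B `^ (1 - r) = (B `^ r) `^ ((1 - r) / r).
      by rewrite -powRrM; congr (_ `^ _); field; rewrite gt_eqF.
    apply: ge0_ler_powR; rewrite ?nnegrE ?powR_ge0 ?(ltW m_gt0)//.
    by rewrite divr_ge0// ltW.
  apply: (@le_trans _ _ (B `^ (1 - r) * B `^ r)).
    by rewrite ler_wpM2r ?powR_ge0.
  rewrite -powRD ?subrK ?powRr1//.
  by rewrite oner_eq0.
have mg j : measurable_fun [set: X] (fun x => c * phi (Some j) x).
  exact: measurable_funM.
have g0 j x : 0 <= c * phi (Some j) x by rewrite mulr_ge0// ltW.
have [g gE] := mfun_family mg.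
have gmg x : \prod_j g j x `^ theta j = c * gm x.
  rewrite /gm -gmeanZ ?(ltW c0)//.
  by apply: eq_bigr => j _; rewrite gE.
exists g; split.
- by move=> j x; rewrite gE.
- rewrite /pow_norm sE.
  have -> : (\int[mu]_x epow `|\prod_j g j x `^ theta j|%:E s = 1)%E.
    have cs : c `^ s = m^-1.
      rewrite /c -powRrM -[RHS](powR_inv1 (ltW m_gt0)); congr (_ `^ _).
      by rewrite /s; field; rewrite ?r1n ?r10n ?r0n.
    rewrite (eq_integral (fun x => (m^-1)%:E * h x)%E); last first.
      move=> x _; rewrite gmg ger0_norm; last by rewrite mulr_ge0// ltW.
      rewrite /h /epow s0 !poweR_EFin powRM ?(ltW c0)// -cs.
      have cs' : (c `^ (- s) == 0) = false by rewrite gt_eqF// powR_gt0.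
      have gs : (gm x `^ (- s) == 0) = (gm x == 0).
        by rewrite powR_eq0 oppr_eq0 (lt_eqF s0) andbT.
      rewrite !inver mulf_eq0 cs' gs /=.
      have [_|_] := eqVneq (gm x) 0.
        have cs0 : (0 < (c `^ s)%:E)%E by rewrite lte_fin powR_gt0.
        by rewrite gt0_muley.
      by rewrite -EFinM invfM powRN invrK.
    rewrite ge0_integralZl_EFin//.
    - by rewrite mE -EFinM mulVf// gt_eqF.
    - by move=> x _; exact: ltW.
    - by rewrite invr_ge0 ltW.
  rewrite /epow invr_lt0 s0 poweR1r inver oner_eq0 invr1.
  by [].
- move=> j f; under eq_integral do rewrite gE.
  have gK v : K j v -> (\int[mu]_x (v x * (c * phi (Some j) x))%:E <= B%:E)%E.
    move=> Kv; have [mv v0] := K_nneg Kv.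
    have -> : (\int[mu]_x (v x * (c * phi (Some j) x))%:E =
        c%:E * \int[mu]_x (v x * phi (Some j) x)%:E)%E.
      rewrite -integralZ_nneg ?(ltW c0)//.
      - by apply: eq_integral => x _; rewrite mulrCA.
      - exact: measurable_funM.
      - by move=> x; rewrite mulr_ge0.
    apply: (@le_trans _ _ (c%:E * (B `^ r)%:E)%E).
      by apply: lee_wpmul2l; [rewrite lee_fin ltW|exact: (phiK (Some j) v Kv)].
    by rewrite -EFinM lee_fin.
  exact: (power_sums_bound (p_ge1 j) (T_linear j)
    (T_positive j) (C_gt0 j) B_ge0 (mg j) (g0 j) gK).
Qed.

End nontrivial_factors.
End factorisation.

Theorem theorem5p1 (R : realType) (disp : measure_display)
  (X : measurableType disp) (mu : {sigma_finite_measure set X -> \bar R})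
  (d : nat) (Y : 'I_d -> normedLatticeType R) (p theta : 'I_d -> R)
  (T : forall j : 'I_d, Y j -> {mfun X >-> R}) (q : \bar R) (B : R)
  (p_ge1 : forall j, 1 <= p j)
  (Y_pconvex : forall j, pconvex (Y j) (p j))
  (T_linear : forall j, ae_linear mu (T j))
  (T_positive : forall j, positive_operator mu (T j))
  (T_saturates : forall j, saturates mu (T j))
  (theta_gt0 : forall j, 0 < theta j)
  (theta_sum : \sum_j theta j = 1)
  (q_gt0 : (0 < q)%E)
  (T_bound : forall f : (forall j, Y j), (forall j, lle 0 (f j)) ->
    ('N[mu]_q [(fun x => (\prod_j T j (f j) x `^ (p j * theta j))%:E)] <=
     (B * \prod_j `|f j| `^ (p j * theta j))%:E)%E) :
  [/\ (q = 1%E ->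
       exists phi : 'I_d -> {mfun X >-> R},
       [/\ forall j x, 0 <= phi j x,
           {ae mu, forall x, 1 <= \prod_j phi j x `^ theta j} &
           forall j (f : Y j),
             ((\int[mu]_x (`|T j f x| `^ p j * phi j x)%:E) `^ (p j)^-1 <=
              (B `^ (p j)^-1 * pconvexity_constant (Y j) (p j) * `|f|)%:E)%E]),
      ((1 < q)%E ->
       forall G : X -> R, (forall x, 0 <= G x) ->
       G \in Lfun mu (hoelder_conjugate q) ->
       exists g : 'I_d -> {mfun X >-> R},
       [/\ forall j x, 0 <= g j x,
           {ae mu, forall x, G x <= \prod_j g j x `^ theta j} &
           forall j (f : Y j),
             ((\int[mu]_x (`|T j f x| `^ p j * g j x)%:E) `^ (p j)^-1 <=
              (B `^ (p j)^-1 * pconvexity_constant (Y j) (p j))%:E *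
              'N[mu]_(hoelder_conjugate q) [EFin \o G] `^ (p j)^-1 *
              `|f|%:E)%E]) &
      ((q < 1)%E -> (0 < mu [set: X])%E ->
       exists g : 'I_d -> {mfun X >-> R},
       [/\ forall j x, 0 <= g j x,
           pow_norm mu (fine (hoelder_conjugate q))
             (fun x => \prod_j g j x `^ theta j) = 1%E &
           forall j (f : Y j),
             ((\int[mu]_x (`|T j f x| `^ p j * g j x)%:E) `^ (p j)^-1 <=
              (B `^ (p j)^-1 * pconvexity_constant (Y j) (p j) * `|f|)%:E)%E])].
Proof.
have mu_sf : sigma_finite [set: X] mu by exact: sigma_finiteT.
(* if some Y j0 is zero then mu is zero, and all weights are good *)
have [[j0 Y0]|nY0] := pselect (exists j0, forall f : Y j0, f = 0).
  have muX0 : mu [set: X] = 0%E by exact: (trivial_factor_null T_linear T_saturates Y0).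
  have ae0 (Q : X -> Prop) : {ae mu, forall x, Q x} by exists [set: X]; split.
  have pc j : 0 <= B `^ (p j)^-1 * pconvexity_constant (Y j) (p j).
    by rewrite mulr_ge0 ?powR_ge0// pconvexity_constant_ge0.
  have int0 j (f : Y j) (g : {mfun X >-> R}) : (forall x, 0 <= g x) ->
      ((\int[mu]_x (`|T j f x| `^ p j * g x)%:E) `^ (p j)^-1 = 0)%E.
    move=> g0.
    have -> : (\int[mu]_x (`|T j f x| `^ p j * g x)%:E = 0)%E.
      rewrite (@ge0_negligible_integral _ _ _ mu _ [set: X])//.
      - by rewrite setDv integral_set0.
      - apply/measurable_EFinP; apply: measurable_funM => //.
        apply: (measurableT_comp (@measurable_powR R (p j))).
        exact: measurableT_comp.
      - by move=> x _; rewrite lee_fin mulr_ge0// powR_ge0.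
    by rewrite poweR0r// invr_eq0 gt_eqF// (lt_le_trans _ (p_ge1 j)).
  split.
  - move=> _; exists (fun=> cst 0); split => //.
    by move=> j f; rewrite int0// lee_fin mulr_ge0.
  - move=> _ G G0 _; exists (fun=> cst 0); split => //.
    move=> j f; rewrite int0//.
    by rewrite mule_ge0 ?lee_fin// mule_ge0 ?lee_fin// poweR_ge0.
  - by rewrite muX0 ltxx.
have Yn0 j : exists f : Y j, f != 0.
  apply: contrapT => nf; apply: nY0; exists j => f.
  by apply/eqP; apply: contra_notT nf => fn0; exists f.
split.
- exact: (case_disentanglement p_ge1 Y_pconvex T_linear T_positive
    T_saturates theta_gt0 theta_sum T_bound mu_sf Yn0).
- exact: (case_duality p_ge1 Y_pconvex T_linear T_positive
    T_saturates theta_gt0 theta_sum T_bound mu_sf Yn0).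
- exact: (case_factorisation p_ge1 Y_pconvex T_linear T_positive
    T_saturates theta_gt0 theta_sum q_gt0 T_bound mu_sf Yn0).
Qed.
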